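(* Let $0<\alpha<1$ and $0<p<1/(1+\alpha)$. Then there exists a constant $c_{\alpha,p}$, depending only on $\alpha$ and $p$, such that for all $F\in H_p(G)$ $$\sum_{m=1}^{\infty}\frac{\left\|\sigma_m^\alpha F\right\|_{H_p}^p}{m^{2-(1+\alpha)p}}\le c_{\alpha,p}\,\|F\|_{H_p}^p .$$
   Context: $\mathbb{N}_+$ is the set of positive integers and $\mathbb{N}=\mathbb{N}_+\cup\{0\}$. The dyadic group: $\mathbb{Z}_2=\{0,1\}$ is the discrete cyclic group of order 2 (addition modulo 2) with the Haar measure giving each singleton measure $1/2$. $G$ is the complete direct product of countably many copies of $\mathbb{Z}_2$, with product topology and product (Haar probability) measure $\mu$; its elements are sequences $x=(x_0,x_1,\ldots)$ with $x_k\in\{0,1\}$. Dyadic intervals: $I_0(x):=G$ and $I_n(x):=\{y\in G: y_0=x_0,\ldots,y_{n-1}=x_{n-1}\}$ for $x\in G$, $n\ge1$. For $0<p<\infty$, $\|f\|_p:=\left(\int_G|f|^p\,d\mu\right)^{1/p}$. Walsh system: the Rademacher functions are $r_k(x):=(-1)^{x_k}$. Each $n\in\mathbb{N}$ is written uniquely as $n=\sum_{j=0}^\infty n_j2^j$ with $n_j\in\{0,1\}$, and $w_n(x):=\prod_{k=0}^\infty r_k(x)^{n_k}$. Martingales and Hardy spaces: $\mathcal{F}_n$ denotes the $\sigma$-algebra generated by the intervals $\{I_n(x):x\in G\}$. A martingale $F=(F_n,\ n\in\mathbb{N})$ is always a martingale with respect to $(\mathcal{F}_n,\ n\in\mathbb{N})$.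 Its maximal function is $F^*:=\sup_{n\in\mathbb{N}}|F_n|$, and for $0<p<\infty$ the Hardy martingale space $H_p(G)$ consists of all martingales $F$ with $\|F\|_{H_p}:=\|F^*\|_p<\infty$. Walsh–Fourier coefficients of a martingale $F$: $\widehat{F}(k):=\lim_{n\to\infty}\int_G F_nw_k\,d\mu$ (the limit exists for every $k\in\mathbb{N}$). Partial sums: $S_nF:=\sum_{k=0}^{n-1}\widehat{F}(k)w_k$ for $n\in\mathbb{N}_+$. A function $f\in L_1(G)$ is identified with the martingale $(S_{2^n}f,\ n\in\mathbb{N})$, for which $\widehat{F}(k)=\int_G f w_k\,d\mu$; its maximal function is $f^*(x)=\sup_{n\in\mathbb{N}}\frac{1}{\mu(I_n(x))}\left|\int_{I_n(x)}f\,d\mu\right|$, and $\|f\|_{H_p}=\|f^*\|_p$. In particular this defines $\|\sigma_m^\alpha F\|_{H_p}$, since $\sigma_m^\alpha F$ is a finite linear combination of Walsh functions. Cesàro means: for $\beta\ne-1,-2,\ldots$ put $A_0^\beta:=1$ and $A_n^\beta:=\frac{(\beta+1)\cdots(\beta+n)}{n!}$ for $n\ge 1$. The $(C,\alpha)$ means are, for $n\in\mathbb{N}_+$, $$\sigma_n^\alpha F:=\frac{1}{A_n^\alpha}\sum_{k=1}^n A_{n-k}^{\alpha-1}S_kF.$$ *)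

(* Defs.v *)
From HB Require Import structures.
From mathcomp Require Import all_boot all_order all_algebra.
From mathcomp Require Import all_classical all_reals all_analysis.
From mathcomp Require Import zify ring lra.
Import Order.TTheory GRing.Theory Num.Theory.
Import numFieldNormedType.Exports.

Set Implicit Arguments.
Unset Strict Implicit.
Unset Printing Implicit Defensive.

Local Open Scope classical_set_scope.
Local Open Scope ring_scope.

(* The n-th dyadic interval containing x; [dyadic_interval 0 x] is everything. *)
Definition dyadic_interval (n : nat) (x : cantor_space) : set cantor_space :=
  [set y | forall k, (k < n)%N -> y k = x k].

Definition dyadic_intervals (n : nat) : set (set cantor_space) :=
  range (dyadic_interval n).

(* The dyadic group: 0/1 sequences (false for 0, true for 1), that is
   [cantor_space] with its product topology, equipped with the sigma-algebra
   generated by all dyadic intervals. These form a countable base of the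
   topology, so this is both the product and the Borel sigma-algebra. The
   group law (coordinatewise addition modulo 2) plays no role below. *)
Definition dyadic_group : Type :=
  g_sigma_algebraType (\bigcup_n dyadic_intervals n).

HB.instance Definition _ := Measurable.on dyadic_group.

Section haar.
Context {R : realType}.
Local Open Scope ereal_scope.

(* [bernoulli_prob 2^-1] is the Haar probability measure of {0, 1}. *)
Definition is_product_measure (mu : set dyadic_group -> \bar R) : Prop :=
  forall (n : nat) (A : nat -> set bool),
    mu [set x | forall k, (k < n)%N -> A k (x k)] =
    \prod_(k < n) bernoulli_prob (2^-1 : R) (A k).

Let coinE (A : set bool) :
  bernoulli_prob (2^-1 : R) A =
  (2^-1 * ((true \in A)%:R + (false \in A)%:R))%:E.
Proof.
rewrite bernoulli_probE; last by lra.
have -> : (unstable.onem (2^-1 : R) = 2^-1)%R by rewrite /unstable.onem; lra.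
by rewrite !diracE -!EFinM -EFinD mulrDr.
Qed.

Let coin1 (b : bool) : bernoulli_prob (2^-1 : R) [set b] = (2^-1)%:E.
Proof.
have e c : (c \in [set b]) = (c == b) by apply/idP/eqP; rewrite inE.
by rewrite coinE !e; case: b {e}; rewrite /= ?addr0 ?add0r mulr1.
Qed.

Let half_itv (m J : nat) : set R :=
  `[(J%:R / 2 ^+ m)%R, (J.+1%:R / 2 ^+ m)%R[%classic.

Let digit (k : nat) (t : R) : bool := odd `|Num.floor (t * 2 ^+ k.+1)%R|%N.

Let digits (t : R) : dyadic_group := fun k => digit k t.

Let measurable_digit k b : measurable [set t : measurableTypeR R | digit k t = b].
Proof.
have -> : [set t : measurableTypeR R | digit k t = b] =
  \bigcup_(z in [set z : int | odd `|z|%N = b])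
    `[(z%:~R / 2 ^+ k.+1)%R, ((z + 1)%:~R / 2 ^+ k.+1)%R[%classic.
  have p0 : (0 < 2 ^+ k.+1 :> R)%R by rewrite exprn_gt0.
  apply/seteqP; split => [t /= tb|t [z /= zb]].
    exists (Num.floor (t * 2 ^+ k.+1)%R) => //=.
    by rewrite in_itv/= ler_pdivrMr// ltr_pdivlMr// floor_itv.
  rewrite in_itv/= ler_pdivrMr// ltr_pdivlMr// => /floor_def.
  by rewrite /digit => ->.
rewrite bigcup_mkcond; apply: countable_bigcupT_measurable => // z.
by case: ifPn => // _; exact: measurable_itv.
Qed.

Let measurable_digits : measurable_fun [set: measurableTypeR R] digits.
Proof.
apply: (@measurability _ _ _ dyadic_group setT digits
  (\bigcup_n dyadic_intervals n)) => //.
move=> _ [_ [n _ [x _ <-]] <-]; rewrite setTI.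
have -> : digits @^-1` dyadic_interval n x =
  \bigcap_(k in `I_n) [set t | digit k t = x k] by [].
apply: bigcap_measurableType => // k _; exact: measurable_digit.
Qed.

Let rect (m n : nat) (A : nat -> set bool) : set R :=
  [set t | forall k, (k < n)%N -> A k (digit (m + k) t)].

Let half_itvS m j : half_itv m j = half_itv m.+1 j.*2 `|` half_itv m.+1 j.*2.+1.
Proof.
have p0 : (0 < 2 ^+ m :> R)%R by rewrite exprn_gt0.
rewrite /half_itv; apply/seteqP; split => t /=;
  rewrite !in_itv/= exprS !(ler_pdivrMr, ltr_pdivlMr) ?mulr_gt0//;
  move: (2 ^+ m : R)%R => q;
  rewrite -[(j.*2.+2)%:R]natr1 -[(j.*2.+1)%:R]natr1 -(natr1 j) -!mul2n !natrM;
  move: (j%:R : R) => u.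
  have [?|?] := ltP (t * (2 * q))%R (2 * u + 1)%R => h.
    by left; lra.
  by right; lra.
by lra.
Qed.

Let measurable_half_itv m j : measurable (half_itv m j : set (measurableTypeR R)).
Proof. exact: measurable_itv. Qed.

Let measurable_rect m n A : measurable (rect m n A : set (measurableTypeR R)).
Proof.
have -> : rect m n A = \bigcap_(k in `I_n) \bigcup_(b in A k)
    [set t | digit (m + k)%N t = b].
  apply/seteqP; split => t /= tA k kn; first by exists (digit (m + k) t) => //; exact: tA.
  by have [b Ab tb] := tA _ kn; rewrite tb.
apply: bigcap_measurableType => // k _; rewrite bigcup_mkcond.
apply: countable_bigcupT_measurable => // b.
by case: ifPn => // _; exact: measurable_digit.
Qed.

Let digit_half_itv m j t : half_itv m.+1 j t -> digit m t = odd j.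
Proof.
have p0 : (0 < 2 ^+ m.+1 :> R)%R by rewrite exprn_gt0.
rewrite /half_itv/= in_itv/= ler_pdivrMr// ltr_pdivlMr// -(natr1 j) => h.
by rewrite /digit (@floor_def _ _ j%:Z)// intrD.
Qed.

Let lebesgue_rect n : forall m j A,
  lebesgue_measure (half_itv m j `&` rect m n A) =
  ((2 ^+ m)^-1)%:E * \prod_(k < n) bernoulli_prob (2^-1 : R) (A k).
Proof.
elim: n => [|n IH] m j A.
  have -> : rect m 0 A = setT by apply/seteqP; split.
  rewrite setIT big_ord0 mule1 /half_itv lebesgue_measure_itv/= lte_fin.
  have p0 : (0 < 2 ^+ m :> R)%R by rewrite exprn_gt0.
  rewrite ltr_pM2r ?invr_gt0// ltr_nat ltnSn -EFinB -mulrBl -natr1.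
  by congr EFin; field; rewrite gt_eqF.
pose B k := A k.+1.
have H i : lebesgue_measure (half_itv m.+1 i `&` rect m n.+1 A) =
    (odd i \in A 0)%:R%:E * (((2 ^+ m.+1)^-1)%:E *
    \prod_(k < n) bernoulli_prob (2^-1 : R) (B k)).
  have [/set_mem Ai|/negP Ai] := boolP (odd i \in A 0%N).
    rewrite mul1e -(IH _ i); congr (lebesgue_measure _).
    apply/seteqP; split => t [ti tA]; split => // k kn.
      by rewrite /B addSnnS; apply: tA.
    case: k kn => [_|k kn]; first by rewrite addn0 (digit_half_itv ti).
    by rewrite -addSnnS; apply: tA.
  rewrite mul0e -[RHS](@measure0 _ _ _ (@lebesgue_measure R)).
  congr (lebesgue_measure _).
  apply/seteqP; split => t //= -[ti /(_ 0%N erefl)].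
  by rewrite addn0 (digit_half_itv ti) => /mem_set.
rewrite half_itvS setIUl measureU//=; last 3 first.
- exact: measurableI.
- exact: measurableI.
- apply/seteqP; split => t //= -[[+ _] [+ _]].
  by move=> /digit_half_itv e /digit_half_itv; rewrite e /= odd_double.
rewrite !H /= odd_double big_ord_recl/= coinE.
have -> : \prod_(i < n) bernoulli_prob (2^-1 : R) (A (lift ord0 i)) =
  \prod_(i < n) bernoulli_prob (2^-1 : R) (B i) by [].
set P := \prod_(i < n) _.
have Pfin : P \is a fin_num.
  rewrite /P; elim/big_ind : _ => // [x y|i _]; first exact: fin_numM.
  by rewrite coinE.
rewrite -(fineK Pfin) -!EFinM -EFinD; congr EFin.
have p0 : (2 ^+ m != 0 :> R)%R by rewrite expf_neq0.
by rewrite exprS; field.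
Qed.

Let unit_itv_measurable : measurable (half_itv 0 0 : set (measurableTypeR R)).
Proof. exact: measurable_itv. Qed.

(* The image of Lebesgue measure on [0, 1[ under binary expansion. *)
Let haar0 :=
  pushforward (mrestr (@lebesgue_measure R) unit_itv_measurable) digits.

Let haar0_product : is_product_measure haar0.
Proof.
move=> n A; rewrite /haar0 /pushforward /mrestr setIC.
by rewrite (lebesgue_rect n 0 0 A) expr0 invr1 mul1e.
Qed.

HB.instance Definition _ := Measure.copy haar0
  (measure_function_pushforward__canonical__measure_function_Measure
    (mrestr (@lebesgue_measure R) unit_itv_measurable) measurable_digits).

Let haar0_setT : haar0 setT = 1.
Proof.
have := haar0_product 0%N (fun=> setT); rewrite big_ord0 => <-.
by congr haar0; apply/seteqP; split.
Qed.

HB.instance Definition _ :=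
  @Measure_isProbability.Build _ _ R haar0 haar0_setT.

Lemma product_measure_exists :
  exists mu : probability dyadic_group R, is_product_measure mu.
Proof. by exists (haar0 : probability dyadic_group R); exact: haar0_product. Qed.

(* The Haar (product) probability measure on the dyadic group; it is uniquely
   determined, see [haar_unique]. *)
Definition haar : probability dyadic_group R := sval (cid product_measure_exists).

Lemma haar_product : is_product_measure haar.
Proof. exact: (svalP (cid product_measure_exists)). Qed.

Lemma product_measure_interval (mu : set dyadic_group -> \bar R) n x :
  is_product_measure mu -> mu (dyadic_interval n x) = ((2 ^+ n)^-1)%:E.
Proof.
move=> /(_ n (fun k => [set x k])) ->.
under eq_bigr do rewrite coin1.
by rewrite prodEFin prodr_const card_ord exprVn.
Qed.

Lemma haar_interval n x : haar (dyadic_interval n x) = ((2 ^+ n)^-1)%:E.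
Proof. exact/product_measure_interval/haar_product. Qed.

Lemma haar_unique (mu : {measure set dyadic_group -> \bar R}) :
  is_product_measure mu -> forall A, measurable A -> mu A = haar A.
Proof.
move=> muP A mA.
pose G : set (set dyadic_group) := (\bigcup_n dyadic_intervals n) `|` [set set0].
have GT : G setT.
  left; exists 0%N => //; exists (fun=> true) => //.
  by apply/seteqP; split.
apply: (@measure_unique _ _ dyadic_group G (fun=> setT)) => //.
- apply/seteqP; split; first by apply: sub_sigma_algebra2 => B GB; left.
  apply: smallest_sub; first exact: sigma_algebra_measurable.
  by move=> B [GB|->]; [exact: sub_sigma_algebra|exact: measurable0].
- have H n x m y : (n <= m)%N ->
     G (dyadic_interval n x `&` dyadic_interval m y).
    move=> nm; have [xy|/existsNP[k /not_implyP[kn xy]]] :=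
      pselect (forall k, (k < n)%N -> x k = y k).
      left; exists m => //; exists y => //; apply/seteqP; split => z /=.
        by move=> zy; split => // k kn; rewrite xy// zy// (leq_trans kn).
      by case.
    right; apply/seteqP; split => // z [/= zx zy]; apply: xy.
    by rewrite -zx// zy// (leq_trans kn).
  move=> _ _ [[n _ [x _ <-]]|->] [[m _ [y _ <-]]|->]; last 3 first.
  + by rewrite setI0; right.
  + by rewrite set0I; right.
  + by rewrite set0I; right.
  by have [|/ltnW] := leqP n m; [|rewrite setIC]; exact: H.
- by rewrite bigcup_const.
- move=> _ [[n _ [x _ <-]]|->]; last by rewrite !measure0.
  by rewrite product_measure_interval//; exact/esym/haar_interval.
- move=> _; rewrite (_ : setT = dyadic_interval 0 (fun=> true)).
    by rewrite product_measure_interval// ltry.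
  by apply/seteqP; split.
Qed.

End haar.

Section walsh.
Context {R : realType}.

Definition rademacher (k : nat) (x : dyadic_group) : R := (-1) ^+ x k.

Definition binary_digit (n k : nat) : nat := odd (n %/ 2 ^ k)%N.

(* As n < 2 ^ n, the binary digits of n of index at least n vanish. *)
Definition walsh (n : nat) (x : dyadic_group) : R :=
  \prod_(k < n) rademacher k x ^+ binary_digit n k.

Definition walsh_sum (c : nat -> R) (n : nat) (x : dyadic_group) : R :=
  \sum_(k < n) c k * walsh k x.

End walsh.

Section hardy.
Context {R : realType}.
Local Notation mu := (@haar R).

Definition dyadic_filtration (n : nat) : set (set dyadic_group) :=
  <<s dyadic_intervals n >>.

Definition dyadic_martingale (F : nat -> dyadic_group -> R) : Prop :=
  [/\ forall n (B : set R), measurable B -> dyadic_filtration n (F n @^-1` B),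
      forall n, mu.-integrable setT (EFin \o F n)
    & forall n m (A : set dyadic_group), (n <= m)%N -> dyadic_filtration n A ->
        (\int[mu]_(x in A) (F m x)%:E = \int[mu]_(x in A) (F n x)%:E)%E].

Definition maximal_function (F : nat -> dyadic_group -> R) (x : dyadic_group) :
  \bar R := ereal_sup (range (fun n => `|F n x|%:E)).

Definition hardy_norm (p : R) (F : nat -> dyadic_group -> R) : \bar R :=
  'N[mu]_(p%:E)[maximal_function F]%E.

Definition hardy_space (p : R) : set (nat -> dyadic_group -> R) :=
  [set F | dyadic_martingale F /\ (hardy_norm p F < +oo)%E].

Definition walsh_coef_fun (f : dyadic_group -> R) (k : nat) : R :=
  \int[mu]_x (f x * walsh k x).

Definition walsh_coef (F : nat -> dyadic_group -> R) (k : nat) : R :=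
  limn (fun n => walsh_coef_fun (F n) k).

(* The sequence (S_(2 ^ n) f)_n with which an integrable f is identified. *)
Definition martingale_of (f : dyadic_group -> R) (n : nat) : dyadic_group -> R :=
  walsh_sum (walsh_coef_fun f) (2 ^ n)%N.

Definition hardy_norm_fun (p : R) (f : dyadic_group -> R) : \bar R :=
  hardy_norm p (martingale_of f).

(* The numbers usually denoted A_n^beta. *)
Definition cesaro_number (beta : R) (n : nat) : R :=
  (\prod_(1 <= i < n.+1) (beta + i%:R)) / n`!%:R.

Definition cesaro_mean (alpha : R) (F : nat -> dyadic_group -> R) (n : nat)
    (x : dyadic_group) : R :=
  (cesaro_number alpha n)^-1 *
  \sum_(1 <= k < n.+1)
    cesaro_number (alpha - 1) (n - k) * walsh_sum (walsh_coef F) k x.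

End hardy.

(* Main.v *)
Require Import Defs.
From mathcomp Require Import all_boot all_order all_algebra.
From mathcomp Require Import all_classical all_reals all_analysis.
From mathcomp Require Import measurable_realfun.
From mathcomp Require Import zify ring lra.
Import Order.TTheory GRing.Theory Num.Theory.
Import numFieldNormedType.Exports.

Set Implicit Arguments.
Unset Strict Implicit.
Unset Printing Implicit Defensive.

Local Open Scope classical_set_scope.
Local Open Scope ring_scope.

(** Fix [m] with [2 ^ (N - 1) <= m < 2 ^ N]. Only the first [N] coordinates matter
    for the [m]-th mean, so conditional expectations become finite averages and
    [F] may be replaced by [F N].

    Pointwise bound. The weights [A_(m-k)^(alpha-1)] are positive and increase with
    [k]. Up to the factor [1 / A_m^alpha], the [n]-th conditional expectation of
    the mean is the sum of [S_k F] for [k <= min(m, 2 ^ n)] with these weights plus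
    a multiple of [F n] that the maximal function of [F] dominates. The
    remaining kernel, a monotone combination of Dirichlet kernels, is at most a
    constant times [2 ^ s * 2 ^ (alpha * l)] at a point whose first two nonzero
    coordinates are [s < l] ([monotone_dirichlet_le]). Hence the mean is
    dominated by the maximal function plus [m ^ (- alpha)] times [spread], a
    combination of the averages of [|F N|] over the dyadic intervals of length
    [2 ^ (- l)] around [x] and around [x] with coordinate [s] flipped
    ([martingale_of_cesaro_mean_le]).

    Norms. Everything is then raised to the power [p < 1], which is subadditive.
    The averages of [|F N|] are not controlled by the maximal function in [L_p],
    but [|F N|] is at most twice a running maximum [doubling] which,
    whenever it changes, at least doubles. Its jumps [J_j] satisfy
    [sum_j J_j ^ p <= C * (max_n |F n|) ^ p] pointwise ([sum_jump_powR_le]), and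
    averaging [J_j], which depends on [j] coordinates, over an interval of length
    [2 ^ (- l)] with [l < j] costs only [2 ^ ((j - l) * (1 - p))] in the
    integral of the [p]-th power ([cavg_powR_le]). This replaces an atomic
    decomposition.

    Summation. The resulting series in [l], in [s] and over the blocks
    [2 ^ n <= m < 2 ^ n.+1] are geometric. Their ratios are governed by
    [2 ^ p > 1], [2 ^ (1 - p) > 1] and [2 ^ ((1 + alpha) * p) / 2], and the last one
    is less than 1 exactly because [p < 1 / (1 + alpha)]. *)

(** * Elementary inequalities *)

Section elementary.
Context {R : realType}.
Variable p : R.
Hypothesis p01 : 0 < p < 1.

Let p_gt0 : 0 < p. Proof. by case/andP: p01. Qed.

Lemma powR_le (u v : R) : 0 <= u -> u <= v -> u `^ p <= v `^ p.
Proof.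
move=> u0 uv; apply: ge0_ler_powR => //; rewrite ?nnegrE//; first exact: ltW.
exact: le_trans uv.
Qed.

Lemma powR_addr_le (u v : R) : 0 <= u -> 0 <= v -> (u + v) `^ p <= u `^ p + v `^ p.
Proof.
rewrite le_eqVlt => /predU1P[<- _|u0]; first by rewrite add0r lerDr powR_ge0.
rewrite le_eqVlt => /predU1P[<-|v0]; first by rewrite addr0 lerDl powR_ge0.
have s0 : 0 < u + v by exact: addr_gt0.
have H z : 0 < z -> z <= u + v -> z / (u + v) * (u + v) `^ p <= z `^ p.
  move=> z0 zs; have q0 : 0 < z / (u + v) by rewrite divr_gt0.
  rewrite -{2}[z](divfK (lt0r_neq0 s0)) powRM ?(ltW q0) ?(ltW s0)//.
  rewrite ler_wpM2r ?powR_ge0// ger1_powR ?q0 ?ler_pdivrMr ?mul1r//.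
  by case/andP: p01 => _ /ltW.
apply: le_trans (lerD (H u u0 _) (H v v0 _)); rewrite ?lerDl ?lerDr ?(ltW u0) ?(ltW v0)//.
by rewrite -mulrDl -mulrDl divff ?gt_eqF// mul1r.
Qed.

Lemma powRV (z : R) : 0 <= z -> (z^-1) `^ p = (z `^ p)^-1.
Proof. by move=> z0; rewrite -powR_inv1// powRAC powR_inv1// powR_ge0. Qed.

Lemma powR_sum_le (I : Type) (r : seq I) (f : I -> R) : (forall i, 0 <= f i) ->
  (\sum_(i <- r) f i) `^ p <= \sum_(i <- r) f i `^ p.
Proof.
move=> f0; elim: r => [|i r IH]; first by rewrite !big_nil powR0 ?gt_eqF.
rewrite !big_cons; apply: (le_trans (powR_addr_le _ _)) => //; first exact: sumr_ge0.
by rewrite lerD2l.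
Qed.

Lemma sum_geometric_le (z : R) n : 1 < z -> \sum_(i < n) z ^+ i <= z ^+ n / (z - 1).
Proof.
move=> z1; rewrite ler_pdivlMr ?subr_gt0// mulrC -subrX1 gerBl//.
Qed.

Lemma sum_geometric_lt1_le (z : R) n : 0 <= z < 1 -> \sum_(i < n) z ^+ i <= (1 - z)^-1.
Proof.
move=> /andP[z0 z1]; rewrite -[leRHS]mul1r ler_pdivlMr ?subr_gt0//.
by rewrite mulrC -opprB mulNr -subrX1 opprB gerBl exprn_ge0.
Qed.

Lemma powR_exprn (z : R) n : 0 <= z -> (z ^+ n) `^ p = (z `^ p) ^+ n.
Proof. by move=> z0; rewrite -!powR_mulrn ?powR_ge0// powRAC. Qed.

Lemma powR2_gt1 (r : R) : 0 < r -> 1 < 2 `^ r.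
Proof. by move=> r0; have := @gt0_ltr_powR R r r0 1 2; rewrite !nnegrE powR1; apply=> //; lra. Qed.

(** Exchanging the two sums turns the sum over [l <= j] into a geometric series of
    ratio [q / k]. *)
Lemma sum_shifted_le (q k : R) (b : nat -> R) N : 0 < k -> 0 < q / k < 1 -> (forall j, 0 <= b j) ->
  \sum_(l < N.+1) q ^+ l * \sum_(i < N - l) k ^+ i.+1 * b (l + i)%N <=
    (1 - q / k)^-1 * \sum_(j < N) k ^+ j.+1 * b j.
Proof.
move=> k0 /andP[r0 r1] b0; elim: N => [|N IH].
  by rewrite big_ord_recl !big_ord0 mulr0 addr0 mulr0.
rewrite big_ord_recr/= subnn big_ord0 mulr0 addr0 [in leRHS]big_ord_recr/= mulrDr.
have -> : \sum_(l < N.+1) q ^+ l * (\sum_(i < N.+1 - l) k ^+ i.+1 * b (l + i)%N) =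
   \sum_(l < N.+1) q ^+ l * (\sum_(i < N - l) k ^+ i.+1 * b (l + i)%N) +
   (\sum_(l < N.+1) (q / k) ^+ l) * (k ^+ N.+1 * b N).
  rewrite mulr_suml -big_split; apply: eq_bigr => l _ /=.
  have lN : (l <= N)%N by rewrite -ltnS.
  rewrite subSn// big_ord_recr/= mulrDr subnKC//; congr (_ + _).
  have -> : k ^+ N.+1 = k ^+ l * k ^+ (N - l).+1 by rewrite -exprD addnS subnKC.
  by rewrite expr_div_n; field; rewrite expf_neq0// gt_eqF.
apply: lerD => //; apply: ler_wpM2r; first by rewrite mulr_ge0// exprn_ge0// ltW.
by apply: sum_geometric_lt1_le; rewrite (ltW r0).
Qed.

(** The [j]-th term appears with the factors [k ^ (j - n)] for [n >= j], again a
    geometric series. *)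
Lemma sum_blocks_le (k : R) (b : nat -> R) K : 1 < k -> (forall j, 0 <= b j) ->
  \sum_(n < K) (k ^+ n)^-1 * \sum_(j < n.+1) k ^+ j.+1 * b j <=
    k / (1 - k^-1) * \sum_(j < K) b j.
Proof.
move=> k1 b0; have k0 : 0 < k by exact: lt_trans k1.
have q1 : 0 < 1 - k^-1 by rewrite subr_gt0 invf_lt1.
(* the second term is the tail of the geometric series still to come *)
suff E : \sum_(n < K) (k ^+ n)^-1 * (\sum_(j < n.+1) k ^+ j.+1 * b j) +
    (1 - k^-1)^-1 * (k ^+ K)^-1 * (\sum_(j < K) k ^+ j.+1 * b j) =
    k / (1 - k^-1) * \sum_(j < K) b j.
  have := ltW q1; have := ltW k0 => k0' q1'.
  rewrite -E lerDl; apply: mulr_ge0; first by rewrite mulr_ge0 ?invr_ge0 ?exprn_ge0.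
  by apply: sumr_ge0 => j _; rewrite mulr_ge0// exprn_ge0.
elim: K => [|K IH]; first by rewrite !big_ord0 !mulr0 addr0.
rewrite big_ord_recr [in RHS]big_ord_recr/= mulrDr -IH.
set E := \sum_(j < K.+1) _.
have -> : \sum_(j < K) k ^+ j.+1 * b j = E - k ^+ K.+1 * b K.
  by rewrite /E big_ord_recr/= addrK.
rewrite !exprS; have : k ^+ K != 0 by rewrite expf_neq0// gt_eqF.
move: q1 k0 k1; move: (k ^+ K) (\sum_(_ < _) _) => z S q1 k0 k1 z0.
field; rewrite z0 subr_eq0 !gt_eqF//.
Qed.

End elementary.

(** * Averages over coordinates *)

Definition set_coord (x : dyadic_group) (k : nat) (b : bool) : dyadic_group :=
  fun i => if i == k then b else x i.

Definition flip (s : nat) (x : dyadic_group) : dyadic_group :=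
  fun i => (i == s) (+) x i.

Definition dyadic_add (x t : dyadic_group) : dyadic_group := fun i => x i (+) t i.

Lemma set_coord_same x k b : set_coord x k b k = b.
Proof. by rewrite /set_coord eqxx. Qed.

Section averages.
Context {R : realType}.
Implicit Types (f g : dyadic_group -> R) (x y t : dyadic_group) (l d n k s : nat).

Definition level n f : Prop :=
  forall x y, (forall k, (k < n)%N -> x k = y k) -> f x = f y.

Definition coord_avg k f x : R := (f (set_coord x k false) + f (set_coord x k true)) / 2.

(** The conditional expectation given the first [l] coordinates, applied to
    functions of the first [l + d] coordinates. *)
Fixpoint cavg l d f : dyadic_group -> R :=
  if d is d'.+1 then coord_avg l (cavg l.+1 d' f) else f.

Definition interval_ind l x t : R := \prod_(i < l) (t i == x i)%:R.

Lemma level_le m n f : (m <= n)%N -> level m f -> level n f.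
Proof. by move=> mn fm x y xy; apply: fm => k km; apply: xy; apply: leq_trans mn. Qed.

Lemma coord_avg_level k f x : level k f -> coord_avg k f x = f x.
Proof.
move=> fk; rewrite /coord_avg.
have h b : f (set_coord x k b) = f x.
  by apply: fk => i ik; rewrite /set_coord ltn_eqF.
by rewrite !h; lra.
Qed.

Lemma cavgSr l d f : cavg l d.+1 f = cavg l d (coord_avg (l + d) f).
Proof.
elim: d l => [|d IH] l; first by rewrite addn0.
rewrite -[LHS]/(coord_avg l (cavg l.+1 d.+1 f)) IH.
by rewrite -[RHS]/(coord_avg l (cavg l.+1 d (coord_avg (l + d.+1) f))) addSnnS.
Qed.

Lemma cavg_tower l d e f : cavg l (d + e) f = cavg l d (cavg (l + d) e f).
Proof.
elim: d l => [|d IH] l; first by rewrite addn0.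
by rewrite addSn /= IH addSnnS.
Qed.

Lemma cavgZ l d a f x : cavg l d (fun t => a * f t) x = a * cavg l d f x.
Proof. by elim: d l x => //= d IH l x; rewrite /coord_avg !IH -mulrDr mulrA. Qed.

Lemma cavgD l d f g x : cavg l d (fun t => f t + g t) x = cavg l d f x + cavg l d g x.
Proof. by elim: d l x => //= d IH l x; rewrite /coord_avg !IH -mulrDl addrACA. Qed.

Lemma cavg_cst l d a x : cavg l d (fun=> a) x = a.
Proof. by elim: d l x => //= d IH l x; rewrite /coord_avg !IH; lra. Qed.

Lemma cavg_sum l d (I : Type) (r : seq I) (P : pred I) (f : I -> dyadic_group -> R) x :
  cavg l d (fun t => \sum_(i <- r | P i) f i t) x = \sum_(i <- r | P i) cavg l d (f i) x.
Proof.
elim: r => [|a r IH].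
  rewrite big_nil -[RHS](cavg_cst l d 0 x).
  by congr cavg; apply/funext => t; rewrite big_nil.
rewrite big_cons -IH; case: ifPn => Pa.
  by rewrite -cavgD; congr cavg; apply/funext => t; rewrite big_cons Pa.
by congr cavg; apply/funext => t; rewrite big_cons (negbTE Pa).
Qed.

Lemma cavg_le l d f g x : (forall t, f t <= g t) -> cavg l d f x <= cavg l d g x.
Proof.
move=> fg; elim: d l x => //= d IH l x.
by rewrite /coord_avg ler_pM2r ?invr_gt0// lerD.
Qed.

Lemma cavg_ge0 l d f x : (forall t, 0 <= f t) -> 0 <= cavg l d f x.
Proof. by move=> f0; rewrite -[0](cavg_cst l d 0 x); exact: cavg_le. Qed.

Lemma cavg_norm l d f x : `|cavg l d f x| <= cavg l d (fun t => `|f t|) x.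
Proof.
rewrite ler_norml -mulN1r -cavgZ; apply/andP; split; apply: cavg_le => t.
  by rewrite mulN1r lerNl -normrN ler_norm.
exact: ler_norm.
Qed.

Lemma level_cavg l d f : level (l + d) f -> level l (cavg l d f).
Proof.
elim: d l => [|d IH] l; first by rewrite addn0.
rewrite -addSnnS => /IH h x y xy /=; rewrite /coord_avg.
have {}h b : cavg l.+1 d f (set_coord x l b) = cavg l.+1 d f (set_coord y l b).
  apply: h => k; rewrite ltnS /set_coord leq_eqVlt; case: eqP => //= _; exact: xy.
by rewrite !h.
Qed.

Lemma cavg_pull l d g f x : level l g ->
  cavg l d (fun t => g t * f t) x = g x * cavg l d f x.
Proof.
elim: d l x => //= d IH l x gl.
have h b : g (set_coord x l b) = g x.
  by apply: gl => i ik; rewrite /set_coord ltn_eqF.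
rewrite /coord_avg !IH; try exact: level_le gl.
by rewrite !h -mulrDr mulrA.
Qed.

Lemma cavg_level l d f : level l f -> cavg l d f = f.
Proof.
move=> fl; apply/funext => x.
rewrite -[LHS]mulr1 -[X in _ = X]mulr1 -[X in _ = f x * X](cavg_cst l d 1 x) -cavg_pull//.
by rewrite mulr1; congr cavg; apply/funext => t; rewrite mulr1.
Qed.

Lemma mean_level n K f : (n <= K)%N -> level n f -> cavg 0 K f = cavg 0 n f.
Proof. by move=> nK fn; rewrite -(subnKC nK) cavg_tower add0n (cavg_level _ fn). Qed.

Lemma mean_cavg l d K f : (l + d <= K)%N -> level (l + d) f ->
  cavg 0 K (cavg l d f) = cavg 0 K f.
Proof.
move=> ldK fl; rewrite [RHS](mean_level ldK)// cavg_tower add0n.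
by apply: mean_level; [lia|exact: level_cavg].
Qed.

Lemma coord_avg_flip l f : coord_avg l (f \o flip l) = coord_avg l f.
Proof.
apply/funext => x; rewrite /coord_avg /= addrC; congr ((f _ + f _) / _);
  by apply/funext => i; rewrite /flip /set_coord; case: eqP.
Qed.

Lemma cavg_flip_out l d s f : (s < l)%N ->
  cavg l d (f \o flip s) = cavg l d f \o flip s.
Proof.
elim: d l => //= d IH l sl; rewrite IH 1?ltnW//.
apply/funext => x; rewrite /coord_avg /=; congr ((cavg _ _ _ _ + cavg _ _ _ _) / _);
  apply/funext => i; rewrite /flip /set_coord; case: (i =P l) => // ->;
  by rewrite gtn_eqF.
Qed.

(** Translation invariance of Haar measure, on functions of finitely many
    coordinates. *)
Lemma cavg_flip l d s f : (l <= s < l + d)%N -> cavg l d (f \o flip s) = cavg l d f.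
Proof.
elim: d l => [|d IH] l; first by lia.
move=> /andP[]; rewrite leq_eqVlt => /predU1P[<- _|ls sd] /=.
  by rewrite cavg_flip_out// coord_avg_flip.
by rewrite IH// ls addSnnS.
Qed.

Lemma interval_ind01 l x t : interval_ind l x t = [forall i : 'I_l, t i == x i]%:R.
Proof.
rewrite /interval_ind; case: (boolP [forall i, _]) => [/forallP h|].
  by rewrite big1// => i _; rewrite h.
rewrite negb_forall => /existsP[i ti].
by rewrite (bigD1 i)//= (negbTE ti) mul0r.
Qed.

Lemma interval_ind_ge0 l x t : 0 <= interval_ind l x t.
Proof. by rewrite interval_ind01 ler0n. Qed.

Lemma interval_ind_eq1 l x t : (forall i, (i < l)%N -> t i = x i) -> interval_ind l x t = 1.
Proof.
by move=> h; rewrite /interval_ind big1// => i _; rewrite h// eqxx.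
Qed.

Lemma level_interval_ind l x : level l (interval_ind l x).
Proof. by move=> t u tu; apply: eq_bigr => i _; rewrite tu. Qed.

Lemma mean_interval_ind l x y : cavg 0 l (interval_ind l x) y = (2 ^+ l)^-1.
Proof.
elim: l => [|l IH]; first by rewrite /interval_ind /= big_ord0 expr0 invr1.
rewrite cavgSr (_ : coord_avg _ _ = fun t => 2^-1 * interval_ind l x t).
  by rewrite cavgZ IH exprS invfM.
apply/funext => t; rewrite add0n /coord_avg /interval_ind !big_ord_recr/= !set_coord_same.
have h b : \prod_(i < l) (set_coord t l b i == x i)%:R = \prod_(i < l) (t i == x i)%:R :> R.
  by apply: eq_bigr => i _; rewrite /set_coord ltn_eqF.
by rewrite !h; case: (x l) => /=; lra.
Qed.

(** Dyadic convolution with the indicator of an interval around zero is, up to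
    normalisation, a conditional expectation. *)
Lemma mean_mul_interval_ind l d f x y : level (l + d) f ->
  cavg 0 (l + d) (fun t => interval_ind l x t * f t) y = (2 ^+ l)^-1 * cavg l d f x.
Proof.
move=> fl; rewrite cavg_tower add0n.
have -> : cavg l d (fun t => interval_ind l x t * f t) = fun t => cavg l d f x * interval_ind l x t.
  apply/funext => t; rewrite cavg_pull; last exact: level_interval_ind.
  rewrite mulrC interval_ind01; case: forallP => h; last by rewrite !mulr0.
  by congr (_ * _); apply: (level_cavg fl) => k kl; apply/eqP; exact: (h (Ordinal kl)).
by rewrite cavgZ mean_interval_ind mulrC.
Qed.

(** Conditional expectation does not contract [L_p] when [p < 1]: each averaged
    coordinate costs a factor [2 / 2 `^ p]. *)
Lemma cavg_powR_le (p : R) l d f x : 0 < p < 1 -> (forall t, 0 <= f t) ->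
  cavg l d f x `^ p <= (2 / 2 `^ p) ^+ d * cavg l d (fun t => f t `^ p) x.
Proof.
move=> p01 f0; elim: d l x => [|d IH] l x /=; first by rewrite expr0 mul1r.
rewrite {1}/coord_avg; set u := cavg l.+1 d f _; set v := cavg l.+1 d f _.
have u0 : 0 <= u by exact: cavg_ge0.
have v0 : 0 <= v by exact: cavg_ge0.
rewrite powRM ?addr_ge0 ?invr_ge0//.
apply: le_trans (ler_wpM2r _ (powR_addr_le p01 u0 v0)) _; first exact: powR_ge0.
apply: le_trans (ler_wpM2r _ (lerD (IH _ _) (IH _ _))) _; first exact: powR_ge0.
rewrite powRV// -mulrDr /coord_avg exprS.
have : 2 `^ p != 0 by rewrite gt_eqF// powR_gt0.
by move: (2 `^ p) => q q0; rewrite le_eqVlt; apply/orP; left; apply/eqP; field.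
Qed.

End averages.

(** * Walsh functions and Dirichlet kernels *)

Section walsh_functions.
Context {R : realType}.
Implicit Types (x t : dyadic_group) (n k q i s l : nat).

Local Notation r := (@rademacher R).
Local Notation w := (@walsh R).

Lemma digit_hi i k : (i < 2 ^ k)%N -> binary_digit i k = 0%N.
Proof. by move=> h; rewrite /binary_digit divn_small. Qed.

Lemma digit_mulD n q i k : (i < 2 ^ n)%N ->
  binary_digit (2 ^ n * q + i) k = (binary_digit (2 ^ n * q) k + binary_digit i k)%N.
Proof.
move=> ilt; have p0 j : (0 < 2 ^ j)%N by rewrite expn_gt0.
have [nk|kn] := leqP n k.
  rewrite (digit_hi (leq_trans ilt _)) ?leq_exp2l// addn0 /binary_digit.
  by rewrite -(subnKC nk) expnD !divnMA mulnC divnMDl// (divn_small ilt) addn0 mulnK.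
rewrite /binary_digit -(subnKC kn) expnD expnS.
have -> : (2 * 2 ^ k * 2 ^ (n - k.+1) * q = 2 * (2 ^ (n - k.+1) * q) * 2 ^ k)%N by ring.
by rewrite divnMDl// mulnK// oddD oddM /=.
Qed.

Lemma walshE i n x : (i < 2 ^ n)%N -> w i x = \prod_(k < n) r k x ^+ binary_digit i k.
Proof.
have aux a b : (a <= b)%N -> (i < 2 ^ a)%N ->
    \prod_(k < b) r k x ^+ binary_digit i k = \prod_(k < a) r k x ^+ binary_digit i k.
  move=> ab ia; rewrite -(subnKC ab) big_split_ord/= [X in _ * X]big1 ?mulr1// => k _.
  by rewrite digit_hi// (leq_trans ia)// leq_exp2l// leq_addr.
move=> ilt; have [ni|/ltnW ni] := leqP n i; first exact: aux.
by rewrite (aux i)// ltn_expl.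
Qed.

Lemma level_walsh i n : (i < 2 ^ n)%N -> level n (w i).
Proof.
move=> ilt x y xy; rewrite !(walshE _ ilt); apply: eq_bigr => k _.
by rewrite /rademacher xy.
Qed.

Lemma walsh_mulD n q i x : (i < 2 ^ n)%N -> w (2 ^ n * q + i) x = w (2 ^ n * q) x * w i x.
Proof.
move=> ilt; pose N := (2 ^ n * q + i)%N.
have h j : (j <= N)%N -> (j < 2 ^ N)%N by move=> /leq_ltn_trans; apply; exact: ltn_expl.
rewrite !(@walshE _ N) ?h ?leq_addr ?leq_addl// -big_split/=.
by apply: eq_bigr => k _; rewrite digit_mulD// exprD.
Qed.

Lemma walsh_pow2 n x : w (2 ^ n) x = r n x.
Proof.
rewrite (@walshE _ n.+1) ?ltn_exp2l// big_ord_recr/= /binary_digit divnn expn_gt0/= expr1.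
rewrite big1 ?mul1r// => k _.
case: k => k /= kn; rewrite -(subnKC kn) addSn -addnS expnD mulKn ?expn_gt0//.
by rewrite expnS oddM.
Qed.

Lemma walsh_dyadic_add i x t : w i (dyadic_add x t) = w i x * w i t.
Proof.
rewrite /walsh -big_split; apply: eq_bigr => k _ /=.
by rewrite -exprMn /rademacher /dyadic_add signr_addb.
Qed.

Lemma norm_walsh i x : `|w i x| = 1.
Proof.
rewrite normr_prod big1// => k _; rewrite normrX /rademacher normrX normrN1.
by rewrite !expr1n.
Qed.

Definition dirichlet k x : R := \sum_(i < k) w i x.

Lemma dirichlet_mulD n q j x : (j <= 2 ^ n)%N ->
  dirichlet (2 ^ n * q + j) x = dirichlet (2 ^ n * q) x + w (2 ^ n * q) x * dirichlet j x.
Proof.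
move=> jlt; rewrite /dirichlet big_split_ord/=; congr (_ + _).
rewrite mulr_sumr; apply: eq_bigr => i _; apply: walsh_mulD.
exact: leq_trans jlt.
Qed.

Lemma dirichlet_pow2 n x : dirichlet (2 ^ n) x = \prod_(k < n) (1 + r k x).
Proof.
elim: n => [|n IH]; first by rewrite /dirichlet big_ord1 big_ord0 /walsh big_ord0.
rewrite big_ord_recr /= -IH expnS mulSn mul1n -{1}[(2 ^ n)%N]muln1.
by rewrite dirichlet_mulD// !muln1 walsh_pow2; ring.
Qed.

Lemma dirichlet_pow2_dyadic_add n x t : dirichlet (2 ^ n) (dyadic_add x t) = 2 ^+ n * interval_ind n x t.
Proof.
rewrite dirichlet_pow2 /interval_ind -[n in 2 ^+ n]card_ord -prodr_const -big_split.
apply: eq_bigr => k _; rewrite /rademacher /dyadic_add.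
by case: (x k) (t k) => -[] /=; ring.
Qed.

Lemma dirichlet_mul0 s n q x : (s < n)%N -> x s -> dirichlet (2 ^ n * q) x = 0.
Proof.
move=> sn xs; have D0 : dirichlet (2 ^ n) x = 0.
  rewrite dirichlet_pow2 (bigD1 (Ordinal sn))//= /rademacher xs.
  by rewrite expr1 subrr mul0r.
elim: q => [|q IH]; first by rewrite muln0 /dirichlet big_ord0.
by rewrite mulnS addnC dirichlet_mulD// IH D0 mulr0 addr0.
Qed.

Lemma dirichlet_norm_le k x : `|dirichlet k x| <= k%:R.
Proof.
apply: le_trans (ler_norm_sum _ _ _) _.
by under eq_bigr do rewrite norm_walsh; rewrite sumr_const card_ord.
Qed.

(** Blocks of length [2 ^ s.+1] of Walsh functions sum to zero at [x] as soon as
    the coordinate [s] of [x] is 1, so only the last, incomplete block counts. *)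
Lemma dirichlet_norm_le_pow2 s k x : x s -> `|dirichlet k x| <= 2 ^+ s.+1.
Proof.
move=> xs; rewrite (divn_eq k (2 ^ s.+1)) mulnC dirichlet_mulD; last first.
  by rewrite ltnW// ltn_pmod// expn_gt0.
rewrite (dirichlet_mul0 _ (ltnSn s) xs) add0r normrM norm_walsh mul1r.
apply: le_trans (dirichlet_norm_le _ _) _.
by rewrite -natrX ler_nat ltnW// ltn_pmod// expn_gt0.
Qed.

(** The [2 ^ l] Walsh functions before index [2 ^ l] sum to zero at [x], and the
    Walsh function of index [2 ^ l] is -1 there. *)
Lemma dirichlet_antiperiodic s l q j x : (s < l)%N -> x s -> x l -> (j < 2 ^ l)%N ->
  dirichlet (2 ^ l.+1 * q + 2 ^ l + j) x = - dirichlet (2 ^ l.+1 * q + j) x.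
Proof.
move=> sl xs xl jl.
have j2 : (2 ^ l + j <= 2 ^ l.+1)%N by rewrite expnS mul2n -addnn leq_add2l ltnW.
have j1 : (j <= 2 ^ l.+1)%N by apply: leq_trans j2; exact: leq_addl.
rewrite -addnA !dirichlet_mulD// (@dirichlet_mul0 s) 1?ltnW//.
rewrite -[(2 ^ l)%N]muln1 dirichlet_mulD 1?ltnW// (@dirichlet_mul0 s)// muln1.
by rewrite walsh_pow2 /rademacher xl; ring.
Qed.

End walsh_functions.

(** * Monotone combinations of Dirichlet kernels *)

Section kernels.
Context {R : realType}.
Implicit Types (x t : dyadic_group) (g a : nat -> R) (k n s l L N T m : nat).

Local Notation D := (@dirichlet R).

(** By antiperiodicity the two halves of a block of length [2 ^ l.+1] contribute
    only differences of weights. For monotone weights these telescope, which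
    leaves at most the weights of the last half block. *)
Lemma monotone_dirichlet_blocks g L s l T x : (s < l)%N -> x s -> x l ->
  (forall k, 0 <= g k) -> (forall k k', (k <= k' < L)%N -> g k <= g k') ->
  (2 ^ l.+1 * T <= L)%N ->
  `|\sum_(0 <= k < 2 ^ l.+1 * T) g k * D k x| <=
    2 ^+ s.+1 * \sum_(2 ^ l.+1 * T - 2 ^ l <= k < 2 ^ l.+1 * T) g k.
Proof.
move=> sl xs xl g0 gmon; elim: T => [|T IH] TL.
  by rewrite muln0 sub0n !big_geq// normr0 mulr0.
set H := (2 ^ l.+1 * T)%N in IH *.
have e2 : (2 ^ l.+1 * T.+1 = H + 2 ^ l + 2 ^ l)%N by rewrite /H mulnS expnS; lia.
rewrite e2 in TL *; set h := (2 ^ l)%N in e2 IH TL *.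
have shift (f : nat -> R) m : \sum_(m <= k < m + h) f k = \sum_(j < h) f (m + j)%N.
  by rewrite -{1}[m]add0n big_addn addKn big_mkord; apply: eq_bigr => i _; rewrite addnC.
have E : \sum_(0 <= k < H + h + h) g k * D k x = \sum_(0 <= k < H) g k * D k x +
    \sum_(j < h) (g (H + j)%N - g (H + h + j)%N) * D (H + j)%N x.
  rewrite (@big_cat_nat _ _ _ H)//=; last by lia.
  congr (_ + _); rewrite (@big_cat_nat _ _ _ (H + h)%N)//=; [|by lia..].
  rewrite !shift -big_split; apply: eq_bigr => j _ /=.
  by rewrite (@dirichlet_antiperiodic R s l T)//; ring.
rewrite E (le_trans (ler_normD _ _))//.
have -> : (H + h + h - h = H + h)%N by lia.
apply: (@le_trans _ _ (2 ^+ s.+1 * \sum_(j < h) g (H + j)%N +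
    2 ^+ s.+1 * \sum_(j < h) (g (H + h + j)%N - g (H + j)%N))); last first.
  rewrite shift -mulrDr -big_split ler_pM2l ?exprn_gt0// ler_sum// => j _ /=.
  by rewrite addrC subrK.
apply: lerD.
  apply: (le_trans (IH _)); first by lia.
  rewrite ler_pM2l ?exprn_gt0//.
  (* truncated subtraction: for [T = 0] the half block before [H] is empty *)
  have [T0|T0] := posnP T.
    by rewrite big_geq ?sumr_ge0// /H T0 muln0.
  have hH : (h <= H)%N.
    by rewrite /H /h expnS (leq_trans (leq_pmulr _ T0))// leq_mul2r; lia.
  rewrite -{2}(subnK hH) shift ler_sum// => j _; apply: gmon.
  by have := ltn_ord j; lia.
apply: (le_trans (ler_norm_sum _ _ _)); rewrite mulr_sumr ler_sum// => j _.
have gj : g (H + j)%N <= g (H + h + j)%N.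
  by apply: gmon; have := ltn_ord j; lia.
rewrite normrM mulrC distrC (ger0_norm (x := _ - _)) ?subr_ge0// ler_wpM2r ?subr_ge0//.
exact: dirichlet_norm_le_pow2.
Qed.

(** To the complete blocks is added the last, incomplete one; all weights that
    survive lie among the last [2 ^ l.+2]. *)
Lemma monotone_dirichlet_two_ones g L s l x : (s < l)%N -> x s -> x l ->
  (forall k, 0 <= g k) -> (forall k k', (k <= k' < L)%N -> g k <= g k') ->
  `|\sum_(0 <= k < L) g k * D k x| <=
    2 ^+ s.+1 * \sum_(L - 2 ^ l.+2 <= k < L) g k.
Proof.
move=> sl xs xl g0 gmon.
pose T := (L %/ 2 ^ l.+1)%N; pose H := (2 ^ l.+1 * T)%N.
have HL : (H <= L)%N by rewrite /H mulnC leq_divM.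
have LH : (L < H + 2 ^ l.+1)%N.
  by rewrite /H mulnC {1}(divn_eq L (2 ^ l.+1)) ltn_add2l ltn_pmod// expn_gt0.
rewrite (@big_cat_nat _ _ _ H)//= (le_trans (ler_normD _ _))//.
apply: (@le_trans _ _ (2 ^+ s.+1 * \sum_(H - 2 ^ l <= k < L) g k)); last first.
  rewrite ler_pM2l ?exprn_gt0// [leRHS](@big_cat_nat _ _ _ (H - 2 ^ l)%N)//=.
  - by rewrite lerDr sumr_ge0.
  - by move: LH; rewrite !expnS; lia.
  - by lia.
rewrite [\sum_(H - _ <= _ < _) _](@big_cat_nat _ _ _ H)//= ?leq_subr// mulrDr.
apply: lerD; first exact: (monotone_dirichlet_blocks (L := L)).
apply: (le_trans (ler_norm_sum _ _ _)); rewrite mulr_sumr ler_sum// => k _.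
by rewrite normrM (ger0_norm (g0 _)) mulrC ler_wpM2r// dirichlet_norm_le_pow2.
Qed.

Lemma reversed_window_le a m L c : (forall u, 0 <= a u) ->
  (forall u v, (u <= v)%N -> a v <= a u) -> (L <= m.+1)%N ->
  \sum_(L - c <= k < L) a (m - k)%N <= \sum_(u < c) a u.
Proof.
move=> a0 amon Lm; rewrite big_nat_rev/= -(big_mkord xpredT a).
have [cL|Lc] := leqP c L.
  rewrite -{1}[(L - c)%N]add0n big_addn subKn// !big_nat ler_sum// => i /andP[_ ic].
  by apply: amon; lia.
have -> : (L - c = 0)%N by lia.
rewrite [leRHS](@big_cat_nat _ _ _ L)//=; last by lia.
rewrite -[leLHS]addr0 lerD ?sumr_ge0// !big_nat ler_sum// => i /andP[_ iL].
by apply: amon; lia.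
Qed.

(** If the first two coordinates of [x] equal to 1 are [s < l], the kernel at [x]
    is of order [2 ^ s] times the total of the [2 ^ l] largest weights. If
    only one coordinate below [N] is 1, then [l] is replaced by [N]; if none is,
    then [s] and [l] are replaced by [N - 1] and [N]. *)
Lemma monotone_dirichlet_le a m L N x t : (0 < N)%N ->
  (forall u, 0 <= a u) -> (forall u v, (u <= v)%N -> a v <= a u) ->
  (L <= m.+1)%N -> (L <= 2 ^ N)%N ->
  `|\sum_(0 <= k < L) a (m - k)%N * D k (dyadic_add x t)| <=
    \sum_(l < N.+1) \sum_(s < l) 2 ^+ s.+1 * (\sum_(u < 2 ^ l.+2) a u) *
      (interval_ind l x t + interval_ind l (flip s x) t).
Proof.
move=> N0 a0 amon Lm LN; set y := dyadic_add x t.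
set S := fun c : nat => \sum_(u < c) a u.
have S0 c : 0 <= S c by rewrite sumr_ge0.
have Smon c d : (c <= d)%N -> S c <= S d.
  move=> cd; rewrite /S -!(big_mkord xpredT a) [leRHS](@big_cat_nat _ _ _ c)//=.
  by rewrite lerDl sumr_ge0.
have full (B : R) : 0 <= B -> (forall k, (k < L)%N -> `|D k y| <= B) ->
    `|\sum_(0 <= k < L) a (m - k)%N * D k y| <= B * S (2 ^ N.+2)%N.
  move=> B0 DB; apply: (@le_trans _ _ (B * S L)); last first.
    apply: ler_wpM2l => //; apply: Smon; apply: (leq_trans LN).
    by rewrite leq_exp2l// -addn2 leq_addr.
  apply: (@le_trans _ _ (B * \sum_(L - L <= k < L) a (m - k)%N)); last first.
    by apply: ler_wpM2l => //; exact: reversed_window_le.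
  rewrite subnn (le_trans (ler_norm_sum _ _ _))// mulr_sumr !big_nat ler_sum// => k /andP[_ kL].
  by rewrite normrM (ger0_norm (a0 _)) mulrC ler_wpM2r// DB.
have [s [l [sl lN yE yQ]]] : exists s l, [/\ (s < l)%N, (l <= N)%N,
    forall i, (i < l)%N -> i != s -> y i = false &
    `|\sum_(0 <= k < L) a (m - k)%N * D k y| <= 2 ^+ s.+1 * S (2 ^ l.+2)%N].
  (* no coordinate of [y] below [N] is 1: then the trivial bound [k] suffices *)
  have [ex1|nex1] := pselect (exists i, (i < N)%N && y i); last first.
    exists N.-1, N; split; rewrite ?prednK//.
      by move=> i iN _; apply/negP => yi; apply: nex1; exists i; rewrite iN yi.
    apply: full => [|k kL]; first by rewrite exprn_ge0.
    apply: (le_trans (dirichlet_norm_le _ _)).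
    by rewrite -natrX ler_nat ltnW// (leq_trans kL).
  case: (ex_minnP ex1) => s /andP[sN ys] smin.
  (* exactly one coordinate is 1: all weights count, as if the second were [N] *)
  have [ex2|nex2] := pselect (exists l, [&& (s < l)%N, (l < N)%N & y l]); last first.
    exists s, N; split => //.
      move=> i iN; rewrite neq_ltn => /orP[i_s|si]; apply/negP => yi.
        by have := smin i; rewrite iN yi leqNgt i_s => /(_ erefl).
      by apply: nex2; exists i; rewrite si iN yi.
    by apply: full => [|k kL]; [rewrite exprn_ge0|exact: dirichlet_norm_le_pow2].
  case: (ex_minnP ex2) => l /and3P[sl lN yl] lmin.
  exists s, l; split => //; first exact: ltnW.
    move=> i il; rewrite neq_ltn => /orP[i_s|si]; apply/negP => yi.
      by have := smin i; rewrite (ltn_trans il lN) yi leqNgt i_s => /(_ erefl).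
    by have := lmin i; rewrite si (ltn_trans il lN) yi leqNgt il => /(_ erefl).
  apply: (le_trans (monotone_dirichlet_two_ones (g := fun k => a (m - k)%N) (L := L) sl ys yl _ _)) => //.
    by move=> k k' /andP[kk' k'L]; apply: amon; lia.
  by rewrite ler_wpM2l ?exprn_ge0//; exact: reversed_window_le.
apply: (le_trans yQ).
have c0 i j : 0 <= 2 ^+ j.+1 * S (2 ^ i.+2)%N * (interval_ind i x t + interval_ind i (flip j x) t).
  by rewrite !mulr_ge0 ?exprn_ge0 ?addr_ge0 ?interval_ind_ge0.
have lN1 : (l < N.+1)%N by [].
rewrite (bigD1 (Ordinal lN1))//= (bigD1 (Ordinal sl))//= -addrA -[leLHS]addr0.
apply: lerD; last by apply: addr_ge0; apply: sumr_ge0 => i _; last (apply: sumr_ge0 => j _); exact: c0.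
rewrite -[leLHS]mulr1 ler_wpM2l ?mulr_ge0 ?exprn_ge0//.
(* [x] and [t] agree below [l] except possibly at [s]: the two intervals *)
have yx i : (i < l)%N -> i != s -> t i = x i.
  by move=> il /(yE _ il); rewrite /y /dyadic_add; case: (x i); case: (t i).
have [ts|/eqP ts] := eqVneq (t s) (x s).
  by rewrite (interval_ind_eq1 (x := x)) ?lerDl ?interval_ind_ge0// => i il; case: (eqVneq i s) => [->//|/yx ->].
rewrite (interval_ind_eq1 (x := flip s x)) ?lerDr ?interval_ind_ge0// => i il.
rewrite /flip; case: (eqVneq i s) => [->|/yx ->]//.
by move: ts; case: (t s) (x s) => -[].
Qed.

End kernels.

(** * Cesaro numbers *)

Section cesaro_numbers.
Context {R : realType}.
Variable alpha : R.
Hypothesis alpha01 : 0 < alpha < 1.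

Local Notation A := (cesaro_number alpha).
Local Notation a := (cesaro_number (alpha - 1)).

Lemma cesaro_number0 (beta : R) : cesaro_number beta 0 = 1.
Proof. by rewrite /cesaro_number big_geq// divr1. Qed.

Lemma cesaro_numberS (beta : R) n :
  cesaro_number beta n.+1 = cesaro_number beta n * ((beta + n.+1%:R) / n.+1%:R).
Proof.
rewrite /cesaro_number big_nat_recr//= factS natrM.
have : n`!%:R != 0 :> R by rewrite pnatr_eq0 -lt0n fact_gt0.
have : n.+1%:R != 0 :> R by rewrite pnatr_eq0.
by move: (n.+1%:R) (n`!%:R) => u v u0 v0; field; rewrite u0 v0.
Qed.

Lemma cesaro_number_pred_ge0 n : 0 <= a n.
Proof.
elim: n => [|n IH]; first by rewrite cesaro_number0.
rewrite cesaro_numberS mulr_ge0// divr_ge0// -natr1.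
by move: alpha01; have := ler0n R n; lra.
Qed.

Lemma cesaro_number_pred_le m n : (m <= n)%N -> a n <= a m.
Proof.
move=> /subnKC <-; elim: (n - m)%N => [|d IH]; first by rewrite addn0.
apply: le_trans IH; rewrite addnS cesaro_numberS ler_piMr ?cesaro_number_pred_ge0//.
rewrite ler_pdivrMr ?ltr0n// mul1r.
by move: alpha01; move: (_%:R) => z; lra.
Qed.

(** The total weight of the Cesaro mean; it rests on
    [A_(k+1)^(alpha-1) = alpha / (k + 1) * A_k^alpha]. *)
Lemma cesaro_number_pred_sum n : \sum_(u < n.+1) a u = A n.
Proof.
have aA k : a k.+1 = A k * (alpha / k.+1%:R).
  elim: k => [|k IH]; first by rewrite cesaro_numberS !cesaro_number0 subrK.
  rewrite cesaro_numberS IH [in RHS]cesaro_numberS.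
  have : k.+1%:R != 0 :> R by rewrite pnatr_eq0.
  have : k.+2%:R != 0 :> R by rewrite pnatr_eq0.
  rewrite -[k.+2%:R]natr1; move: (k.+1%:R) => u u1 u0.
  by field; rewrite u0 u1.
elim: n => [|n IH]; first by rewrite big_ord1 !cesaro_number0.
rewrite big_ord_recr/= IH aA cesaro_numberS.
have : n.+1%:R != 0 :> R by rewrite pnatr_eq0.
by move: (n.+1%:R) => u u0; field.
Qed.

(** Bernoulli's inequality, from Young's inequality with exponents [1 / alpha]
    and [1 / (1 - alpha)]. *)
Lemma powR_le_tangent (w : R) : 0 <= w -> w `^ alpha <= alpha * w + (1 - alpha).
Proof.
move: alpha01 => /andP[a0 a1] w0.
have b0 : 0 < 1 - alpha by lra.
have := @conjugate_powR R (w `^ alpha) 1 alpha^-1 (1 - alpha)^-1.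
rewrite !invr_gt0 !invrK mulr1 powR1 mul1r -powRrM mulfV ?gt_eqF// powRr1// mulrC => -> //.
- exact: powR_ge0.
- by rewrite addrC subrK.
Qed.

Lemma cesaro_number_ge n : n.+1%:R `^ alpha <= A n.
Proof.
elim: n => [|n IH]; first by rewrite cesaro_number0 powR1.
have n0 : 0 < n.+1%:R :> R by rewrite ltr0n.
rewrite cesaro_numberS; apply: le_trans (ler_wpM2r _ IH); last first.
  by rewrite divr_ge0// addr_ge0 ?ltW//; case/andP: alpha01.
rewrite -[n.+2%:R](divfK (lt0r_neq0 n0)) powRM ?divr_ge0// mulrC ler_wpM2l ?powR_ge0//.
apply: (le_trans (powR_le_tangent _)); first by rewrite divr_ge0.
rewrite -[n.+2%:R]natr1 le_eqVlt; apply/orP; left; apply/eqP.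
by move: (n.+1%:R) n0 => u u0; field; rewrite gt_eqF.
Qed.

Lemma cesaro_number_gt0 n : 0 < A n.
Proof. by apply: lt_le_trans (cesaro_number_ge n); rewrite powR_gt0. Qed.

Lemma cesaro_number_le n : A n.+1 <= 2 * n.+1%:R `^ alpha.
Proof.
move: (alpha01) => /andP[a0 a1].
elim: n => [|n IH]; first by rewrite cesaro_numberS cesaro_number0 powR1; lra.
rewrite cesaro_numberS; set z : R := n.+2%:R.
have z0 : 0 < z by rewrite ltr0n.
have nz : n.+1%:R = z - 1 by rewrite /z -[n.+2%:R]natr1 addrK.
have z1 : 0 <= z - 1 by rewrite -nz.
apply: (le_trans (ler_wpM2r _ IH)); first by rewrite divr_ge0 ?addr_ge0 ?ltW.
rewrite -mulrA ler_pM2l//.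
have -> : n.+1%:R = z * ((z - 1) / z) :> R by rewrite mulrC divfK ?gt_eqF.
have q0 : 0 <= (z - 1) / z by rewrite divr_ge0// ltW.
rewrite powRM ?(ltW z0)// -mulrA ler_piMr ?powR_ge0//.
apply: (@le_trans _ _ ((1 - alpha / z) * (1 + alpha / z))); last first.
  by rewrite -subr_sqr expr1n gerBl sqr_ge0.
have -> : (alpha + z) / z = 1 + alpha / z by rewrite mulrDl divff ?gt_eqF// addrC.
apply: ler_wpM2r; first by rewrite addr_ge0 ?divr_ge0 ?ltW.
apply: (le_trans (powR_le_tangent q0)).
by rewrite le_eqVlt; apply/orP; left; apply/eqP; field; rewrite gt_eqF.
Qed.

Lemma cesaro_number_pred_sum_pow2 l : \sum_(u < 2 ^ l) a u <= 2 * (2 `^ alpha) ^+ l.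
Proof.
have p : (0 < 2 ^ l)%N by rewrite expn_gt0.
have aa : (2 `^ alpha) ^+ l = (2 ^ l)%:R `^ alpha.
  by rewrite natrX -!powR_mulrn ?powR_ge0// -!powRrM mulrC.
rewrite aa -(prednK p); apply: le_trans (cesaro_number_le _).
by rewrite -cesaro_number_pred_sum [leRHS]big_ord_recr/= lerDl cesaro_number_pred_ge0.
Qed.

End cesaro_numbers.

(** * Partial sums and conditional expectations *)

Section partial_sums.
Context {R : realType}.
Implicit Types (x t y : dyadic_group) (f : dyadic_group -> R) (c : nat -> R) (k n i N m l : nat).

Local Notation w := (@walsh R).
Local Notation D := (@dirichlet R).

Lemma walsh_sum_convolution N f c k x y :
  (forall i, (i < k)%N -> c i = cavg 0 N (fun t => f t * w i t) y) ->
  walsh_sum c k x = cavg 0 N (fun t => f t * D k (dyadic_add x t)) y.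
Proof.
move=> cE; rewrite /walsh_sum.
under eq_bigr => i _ do rewrite (cE _ (ltn_ord i)) mulrC -cavgZ.
rewrite -cavg_sum; congr (cavg _ _ _ y); apply/funext => t.
rewrite /dirichlet mulr_sumr; apply: eq_bigr => i _.
by rewrite walsh_dyadic_add; ring.
Qed.

(** The Dirichlet kernel of index [2 ^ n] is [2 ^ n] times the indicator of a
    dyadic interval, so the partial sum of that index is a conditional
    expectation. *)
Lemma walsh_sum_pow2 d n f c x y : level (n + d) f ->
  (forall i, (i < 2 ^ n)%N -> c i = cavg 0 (n + d) (fun t => f t * w i t) y) ->
  walsh_sum c (2 ^ n) x = cavg n d f x.
Proof.
move=> fl cE; rewrite (walsh_sum_convolution x cE).
have -> : (fun t => f t * D (2 ^ n) (dyadic_add x t)) = fun t => 2 ^+ n * (interval_ind n x t * f t).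
  by apply/funext => t; rewrite dirichlet_pow2_dyadic_add; ring.
by rewrite cavgZ mean_mul_interval_ind// mulrA divff ?mul1r// expf_neq0.
Qed.

Lemma level_walsh_sum c k N : (k <= 2 ^ N)%N -> level N (walsh_sum c k).
Proof.
move=> kN x z xz; apply: eq_bigr => i _; congr (_ * _).
by apply: (@level_walsh _ i N) => //; apply: leq_trans kN.
Qed.

(** Averaging over the coordinate of the leading binary digit of [i] kills the
    Walsh function of index [i]. *)
Lemma cavg_walsh_hi n d i x : (2 ^ n <= i < 2 ^ (n + d))%N -> cavg n d (w i) x = 0.
Proof.
move=> /andP[ni ilt]; have i0 : (0 < i)%N by apply: leq_trans ni; rewrite expn_gt0.
have /andP[] := trunc_log_bounds (erefl : (1 < 2)%N) i0.
set b := trunc_log 2 i => bi ib.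
have nb : (n <= b)%N by rewrite -ltnS -(@ltn_exp2l 2)// (leq_ltn_trans ni).
have bd : (b < n + d)%N by rewrite -(@ltn_exp2l 2)// (leq_ltn_trans bi).
(* the coordinates above [b] do not matter, so [b] is averaged first *)
have -> : d = ((b - n).+1 + (n + d - b.+1))%N by lia.
have e : (n + (b - n) = b)%N by lia.
rewrite cavg_tower [cavg (_ + _) _ _]cavg_level; last by rewrite addnS e; exact: level_walsh.
rewrite cavgSr e (_ : coord_avg b (w i) = fun=> 0) ?cavg_cst//.
apply/funext => z; rewrite /coord_avg.
have jb : (i - 2 ^ b < 2 ^ b)%N by move: ib; rewrite expnS; lia.
have wE (e1 : bool) : w i (set_coord z b e1) = (-1) ^+ e1 * w (i - 2 ^ b)%N z.
  rewrite -{1}(subnKC bi) -{1}[(2 ^ b)%N]muln1 walsh_mulD// muln1 walsh_pow2.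
  rewrite /rademacher set_coord_same; congr (_ * _).
  by apply: (level_walsh jb) => k kb; rewrite /set_coord ltn_eqF.
by rewrite !wE; ring.
Qed.

Lemma cavg_walsh_sum n d c k x : (k <= 2 ^ (n + d))%N ->
  cavg n d (walsh_sum c k) x = walsh_sum c (minn k (2 ^ n)) x.
Proof.
move=> kd; rewrite /walsh_sum cavg_sum.
under eq_bigr do rewrite cavgZ.
have low i : (i < 2 ^ n)%N -> cavg n d (w i) x = w i x.
  by move=> ilt; rewrite cavg_level//; exact: level_walsh.
have [kn|/ltnW nk] := leqP k (2 ^ n).
  by apply: eq_bigr => i _; rewrite low// (leq_trans _ kn).
rewrite -[in LHS](subnKC nk) big_split_ord/= [X in _ + X]big1 ?addr0.
  by apply: eq_bigr => i _; rewrite low.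
move=> i _; rewrite cavg_walsh_hi ?mulr0// leq_addr/=.
by apply: leq_trans kd; rewrite -ltn_subRL.
Qed.

End partial_sums.

(** * The doubling majorant *)

Section doubling_majorant.
Context {R : realType}.
Variable F : nat -> dyadic_group -> R.
Implicit Types (x : dyadic_group) (l d k n j : nat).

(** A running maximum of [|F n|] that is updated only when the new value is at
    least twice the old one. *)
Fixpoint doubling n x : R :=
  if n is n'.+1 then
    if 2 * doubling n' x <= `|F n x| then `|F n x| else doubling n' x
  else `|F 0 x|.

Definition jump n x : R := doubling n.+1 x - doubling n x.

Lemma doubling_ge0 n x : 0 <= doubling n x.
Proof. by elim: n => //= n IH; case: ifP. Qed.

Lemma norm_le_doubling n x : `|F n x| <= 2 * doubling n x.
Proof.
case: n => /= [|n]; first by have := normr_ge0 (F 0 x); lra.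
have := normr_ge0 (F n.+1 x).
by case: ifPn => [_|]; [lra|rewrite -ltNge => /ltW].
Qed.

Lemma doublingS n x : doubling n.+1 x = doubling n x \/
  2 * doubling n x <= doubling n.+1 x.
Proof. by rewrite /=; case: ifP; [right|left]. Qed.

Lemma jump_ge0 n x : 0 <= jump n x.
Proof.
rewrite subr_ge0; have := doubling_ge0 n x.
by case: (doublingS n x) => [->//|]; lra.
Qed.

Lemma doubling_attained n x : exists k, doubling n x = `|F k x|.
Proof. by elim: n => [|n IH] /=; [exists 0%N|case: ifP => // _; exists n.+1]. Qed.

Lemma level_doubling n : (forall k, level k (F k)) -> level n (doubling n).
Proof.
move=> Fl; elim: n => [|n IH] x y xy /=; first by rewrite (Fl _ _ _ xy).
by rewrite (Fl _ _ _ xy) (IH x y)// => k kn; apply: xy; exact: ltnW.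
Qed.

Lemma level_jump n : (forall k, level k (F k)) -> level n.+1 (jump n).
Proof.
move=> Fl x y xy; rewrite /jump (level_doubling Fl xy).
by rewrite (level_doubling (n := n) Fl (y := y))// => k kn; apply: xy; exact: ltnW.
Qed.

Variable p : R.
Hypothesis p01 : 0 < p < 1.

Let p_gt0 : 0 < p. Proof. by case/andP: p01. Qed.

Let pi2_gt1 : 1 < 2 `^ p. Proof. exact: powR2_gt1. Qed.

(** Since the majorant at least doubles when it changes, the [p]-th powers of its
    jumps add up like a geometric series; for the increments of the plain
    running maximum this would fail when [p < 1]. *)
Lemma sum_jump_powR_le n x :
  \sum_(j < n) jump j x `^ p <= (1 - (2 `^ p)^-1)^-1 * doubling n x `^ p.
Proof.
have q0 : 0 < 1 - (2 `^ p)^-1 by rewrite subr_gt0 invf_lt1// (lt_trans ltr01).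
elim: n => [|n IH]; first by rewrite big_ord0 mulr_ge0 ?powR_ge0// invr_ge0 ltW.
rewrite big_ord_recr/= -/(doubling n.+1 x).
apply: (le_trans (lerD IH (lexx _))).
have [E|E] := doublingS n x.
  by rewrite /jump E subrr powR0 ?gt_eqF// addr0.
have Jle : jump n x `^ p <= doubling n.+1 x `^ p.
  by apply: powR_le => //; rewrite ?jump_ge0// gerBl doubling_ge0.
have Gle : doubling n x `^ p <= doubling n.+1 x `^ p / 2 `^ p.
  rewrite ler_pdivlMr ?powR_gt0// mulrC -powRM ?doubling_ge0//.
  by apply: powR_le => //; rewrite mulr_ge0// doubling_ge0.
rewrite -(ler_pM2l q0) mulrDr !mulrA mulfV ?gt_eqF// !mul1r.
apply: (le_trans (lerD Gle (ler_wpM2l (ltW q0) Jle))).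
by rewrite mulrBl mul1r [(2 `^ p)^-1 * _]mulrC addrC subrK.
Qed.

(** The increments after time [l] are averaged one at a time: the [j]-th one only
    over the coordinates from [l] to [j], where it is nonconstant. *)
Lemma cavg_doubling_powR_le l d x : (forall k, level k (F k)) ->
  cavg l d (doubling (l + d)) x `^ p <= doubling l x `^ p +
    \sum_(i < d) (2 / 2 `^ p) ^+ i.+1 * cavg l i.+1 (fun t => jump (l + i) t `^ p) x.
Proof.
move=> Fl; elim: d => [|d IH]; first by rewrite addn0 big_ord0 addr0.
have -> : doubling (l + d.+1) = fun t => doubling (l + d) t + jump (l + d) t.
  by apply/funext => t; rewrite addnS addrC subrK.
rewrite cavgD {1}cavgSr (_ : coord_avg _ (doubling _) = doubling (l + d)); last first.
  by apply/funext => t; rewrite coord_avg_level//; exact: level_doubling.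
apply: (le_trans (powR_addr_le _ _ _)) => //; try (apply: cavg_ge0 => t).
- exact: doubling_ge0.
- exact: jump_ge0.
rewrite big_ord_recr/= addrA lerD//.
apply: (@cavg_powR_le _ p l d.+1) => // t; exact: jump_ge0.
Qed.

End doubling_majorant.

(** * The operator dominating the Cesaro means *)

Section spread.
Context {R : realType}.
Implicit Types (x t y : dyadic_group) (f : dyadic_group -> R) (q : R) (k n i N m l s L K d : nat).

(** What remains of the Cesaro kernel after convolution: the kernel has size
    [2 ^ s * q ^ l], with [q] equal to [2] to the power [alpha], on the points whose
    first two nonzero coordinates are [s < l], and these lie in two intervals of
    length [2 ^ (- l)]. *)
Definition spread q N f x : R :=
  \sum_(l < N.+1) \sum_(s < l) 2 ^+ s / 2 ^+ l * q ^+ l *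
    (cavg l (N - l) (fun t => `|f t|) x + cavg l (N - l) (fun t => `|f t|) (flip s x)).

Lemma spread_ge0 q N f x : 0 <= q -> 0 <= spread q N f x.
Proof.
move=> q0; apply: sumr_ge0 => l _; apply: sumr_ge0 => s _.
by rewrite !mulr_ge0 ?invr_ge0 ?exprn_ge0 ?addr_ge0 ?cavg_ge0.
Qed.

Lemma level_spread q N f : level N f -> level N (spread q N f).
Proof.
move=> fl x y xy; apply: eq_bigr => l _; apply: eq_bigr => s _.
have lN : (l <= N)%N by rewrite -ltnS.
have afl : level (l + (N - l)) (fun t => `|f t|).
  by rewrite subnKC// => t u tu; rewrite (fl _ _ tu).
have cl := level_cavg afl.
congr (_ * (_ + _)); apply: cl => k kl.
  by apply: xy; apply: leq_trans lN.
by rewrite /flip xy//; apply: leq_trans lN.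
Qed.

Lemma weighted_partial_sums_le (alpha : R) N f (c : nat -> R) m L x y :
  0 < alpha < 1 -> (0 < N)%N -> level N f -> (L <= m.+1)%N -> (L <= 2 ^ N)%N ->
  (forall i, (i < L)%N -> c i = cavg 0 N (fun t => f t * walsh i t) y) ->
  `|\sum_(0 <= k < L) cesaro_number (alpha - 1) (m - k) * walsh_sum c k x| <=
    16 * spread (2 `^ alpha) N f x.
Proof.
move=> alpha01 N0 fl Lm LN cE; set a := cesaro_number (alpha - 1).
have alpha0 : 0 <= alpha by case/andP: alpha01 => /ltW.
have a2 : 2 `^ alpha <= 2.
  by rewrite ler1_powR ?ler1n//; case/andP: alpha01 => _ /ltW.
pose Q t := \sum_(0 <= k < L) a (m - k)%N * dirichlet k (dyadic_add x t).
have -> : \sum_(0 <= k < L) a (m - k)%N * walsh_sum c k x =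
    cavg 0 N (fun t => f t * Q t) y.
  rewrite !big_mkord; under eq_bigr => k _.
    rewrite (@walsh_sum_convolution _ N f c k x y); last first.
      by move=> i ik; apply: cE; apply: ltn_trans (ltn_ord k).
    rewrite -cavgZ; over.
  rewrite -cavg_sum; congr (cavg _ _ _ y); apply/funext => t.
  by rewrite /Q big_mkord mulr_sumr; apply: eq_bigr => k _; rewrite mulrCA.
apply: (le_trans (cavg_norm _ _ _ _)).
pose coef l s : R := 2 ^+ s.+1 * \sum_(u < 2 ^ l.+2) a u.
pose B t := \sum_(l < N.+1) \sum_(s < l) coef l s *
  (interval_ind l x t * `|f t| + interval_ind l (flip s x) t * `|f t|).
apply: (@le_trans _ _ (cavg 0 N B y)).
  apply: cavg_le => t; rewrite normrM mulrC.
  apply: (le_trans (ler_wpM2r (normr_ge0 _) (monotone_dirichlet_le x t N0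
    (cesaro_number_pred_ge0 alpha01) (cesaro_number_pred_le alpha01) Lm LN))).
  rewrite mulr_suml ler_sum// => l _; rewrite mulr_suml ler_sum// => s _.
  by rewrite -[leLHS]mulrA [(interval_ind _ _ _ + _) * _]mulrDl.
rewrite /B cavg_sum /spread mulr_sumr ler_sum// => l _.
rewrite cavg_sum mulr_sumr ler_sum// => s _.
rewrite cavgZ cavgD.
have lN : (l <= N)%N by rewrite -ltnS.
have mulind z : cavg 0 N (fun t => interval_ind l z t * `|f t|) y =
    (2 ^+ l)^-1 * cavg l (N - l) (fun t => `|f t|) z.
  have := @mean_mul_interval_ind R l (N - l) (fun t => `|f t|) z y; rewrite subnKC//; apply.
  by move=> t u tu; rewrite (fl _ _ tu).
rewrite !mulind -mulrDr mulrA [leRHS]mulrA; apply: ler_wpM2r.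
  by rewrite addr_ge0// cavg_ge0.
have S := cesaro_number_pred_sum_pow2 alpha01 l.+2.
rewrite /coef.
set P := 2 `^ alpha in S a2 *.
have P0 : 0 <= P by exact: powR_ge0.
have PP : P ^+ l.+2 <= 4 * P ^+ l.
  rewrite exprS exprS mulrA ler_wpM2r ?exprn_ge0//.
  by rewrite (_ : 4 = 2 * 2) ?ler_pM// -natrM.
have i0 : 0 <= (2 ^+ l)^-1 :> R by rewrite invr_ge0 exprn_ge0.
have s0 : 0 <= 2 ^+ s :> R by rewrite exprn_ge0.
apply: (@le_trans _ _ ((2 ^+ s.+1 * (8 * P ^+ l)) * (2 ^+ l)^-1)).
  rewrite ler_wpM2r// ler_wpM2l ?exprn_ge0//.
  by apply: (le_trans S); lra.
by rewrite le_eqVlt; apply/orP; left; apply/eqP; rewrite exprS; ring.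
Qed.

Variable p : R.
Hypothesis p01 : 0 < p < 1.

Let p_gt0 : 0 < p. Proof. by case/andP: p01. Qed.

Lemma mean_flip_powR K f s y : (s < K)%N ->
  cavg 0 K (fun x => f (flip s x) `^ p) y = cavg 0 K (fun x => f x `^ p) y.
Proof. by move=> sK; rewrite -(@cavg_flip _ 0 K s (fun x => f x `^ p)). Qed.

(** Flipping a coordinate preserves the mean, so the sum over [s] is a geometric
    series of ratio [2 `^ p > 1], comparable to its last term. *)
Lemma mean_spread_powR_le q N K f y : 0 <= q -> (N <= K)%N ->
  cavg 0 K (fun x => spread q N f x `^ p) y <= 2 / (2 `^ p - 1) *
    \sum_(l < N.+1) (q `^ p) ^+ l *
      cavg 0 K (fun x => cavg l (N - l) (fun t => `|f t|) x `^ p) y.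
Proof.
move=> q0 NK; set pi2 := 2 `^ p.
have pi1 : 1 < pi2 by exact: powR2_gt1.
pose u l := cavg l (N - l) (fun t => `|f t|).
have u0 l x : 0 <= u l x by exact: cavg_ge0.
pose V x := \sum_(l < N.+1) \sum_(s < l) (pi2 ^+ s / pi2 ^+ l * (q `^ p) ^+ l) *
  (u l x `^ p + u l (flip s x) `^ p).
apply: (@le_trans _ _ (cavg 0 K V y)).
  apply: cavg_le => x; rewrite /spread.
  have c0 l s : 0 <= 2 ^+ s / 2 ^+ l * q ^+ l :> R.
    by rewrite !mulr_ge0 ?invr_ge0 ?exprn_ge0.
  apply: (le_trans (powR_sum_le p01 _ _)) => [l|].
    by apply: sumr_ge0 => s _; rewrite mulr_ge0// addr_ge0// u0.
  rewrite ler_sum// => l _.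
  apply: (le_trans (powR_sum_le p01 _ _)) => [s|].
    by rewrite mulr_ge0// addr_ge0// u0.
  rewrite ler_sum// => s _; rewrite powRM//; last by rewrite addr_ge0// u0.
  rewrite !powRM ?mulr_ge0 ?invr_ge0 ?exprn_ge0// !powR_exprn//.
  rewrite powRV ?exprn_ge0// powR_exprn//.
  rewrite ler_wpM2l ?powR_addr_le ?u0//.
  by rewrite !mulr_ge0 ?invr_ge0 ?exprn_ge0 ?powR_ge0.
rewrite /V cavg_sum mulr_sumr ler_sum// => l _; rewrite cavg_sum.
have lN : (l <= N)%N by rewrite -ltnS.
under eq_bigr => s _ do rewrite cavgZ cavgD
  (mean_flip_powR (u l) y (leq_trans (ltn_ord s) (leq_trans lN NK))).
rewrite -/(u l) -mulr_suml -mulr_suml -mulr_suml.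
set M := cavg 0 K _ y.
have M0 : 0 <= M by apply: cavg_ge0 => t; exact: powR_ge0.
have G : (\sum_(s < l) pi2 ^+ s) / pi2 ^+ l <= (pi2 - 1)^-1.
  rewrite ler_pdivrMr ?exprn_gt0 ?(lt_trans ltr01)// mulrC.
  exact: sum_geometric_le.
have -> : 2 / (pi2 - 1) * ((q `^ p) ^+ l * M) = (pi2 - 1)^-1 * ((q `^ p) ^+ l * (M + M)) by ring.
by rewrite -mulrA ler_wpM2r ?mulr_ge0 ?addr_ge0 ?exprn_ge0 ?powR_ge0.
Qed.

End spread.

(** * Integrals of functions of finitely many coordinates *)

Section integrals.
Context {R : realType}.
Local Notation mu := (@haar R).
Implicit Types (x t y : dyadic_group) (f : dyadic_group -> R) (l d n k N m : nat).

(** Saturated sets form a sigma-algebra containing the generating intervals. *)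
Lemma dyadic_filtration_saturated n (A : set dyadic_group) x y :
  dyadic_filtration n A -> (forall k, (k < n)%N -> x k = y k) -> A x -> A y.
Proof.
pose C : set (set dyadic_group) :=
  [set A | forall x y, (forall k, (k < n)%N -> x k = y k) -> A x -> A y].
suff : dyadic_filtration n `<=` C by move=> h /h; exact.
apply: smallest_sub.
  split => [|B BC u v uv [_ nBu]|B BC u v uv [i _ Bu]].
  - by [].
  - by split => // Bv; apply: nBu; apply: BC Bv => k kn; rewrite uv.
  - by exists i => //; apply: BC Bu.
move=> _ [z _ <-] u v uv zu k kn /=; rewrite -uv//; exact: zu.
Qed.

Lemma level_adapted n f :
  (forall B : set R, measurable B -> dyadic_filtration n (f @^-1` B)) -> level n f.
Proof.
move=> fB x y xy.
have := dyadic_filtration_saturated (fB [set f x] (measurable_set1 _)) xy.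
by move=> /(_ erefl).
Qed.

Lemma measurable_dyadic_interval n x : measurable (dyadic_interval n x : set dyadic_group).
Proof. by apply: sub_sigma_algebra; exists n => //; exists x. Qed.

Lemma measurable_level n f : level n f -> measurable_fun setT f.
Proof.
move=> fn _ B mB; rewrite setTI.
pose ext (s : seq bool) : dyadic_group := nth false s.
have -> : f @^-1` B = \bigcup_(s in [set s | B (f (ext s))]) dyadic_interval n (ext s).
  apply/seteqP; split => [x Bx|x [s /= Bs xs]]; last first.
    by rewrite /= (fn _ _ xs).
  have ex k : (k < n)%N -> ext (mkseq x n) k = x k by move=> kn; rewrite /ext nth_mkseq.
  exists (mkseq x n); first by rewrite /= (fn _ _ ex).
  by move=> k kn; rewrite ex.
rewrite [X in measurable X]bigcup_mkcond; apply: countable_bigcupT_measurable => // s.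
by case: ifPn => // _; exact: measurable_dyadic_interval.
Qed.

Lemma dyadic_interval_split l x : dyadic_interval l x =
  dyadic_interval l.+1 (set_coord x l false) `|` dyadic_interval l.+1 (set_coord x l true).
Proof.
have sub (e : bool) : dyadic_interval l.+1 (set_coord x l e) `<=` dyadic_interval l x.
  by move=> y h k kl; rewrite h 1?ltnW//= /set_coord ltn_eqF.
apply/seteqP; split => [y yx|y [|]]; [|exact: sub..].
have h (e : bool) : y l = e -> dyadic_interval l.+1 (set_coord x l e) y.
  move=> yl k; rewrite ltnS leq_eqVlt /set_coord; case: eqP => [->//|_ /= kl].
  exact: yx.
by case yl : (y l); [right|left]; apply: h.
Qed.

(** Halving the interval [d] times leaves constant functions. *)
Lemma integral_level l d f x : level (l + d) f ->
  (\int[mu]_(y in dyadic_interval l x) (f y)%:E = ((2 ^+ l)^-1 * cavg l d f x)%:E)%E.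
Proof.
elim: d l x => [|d IH] l x fl.
  rewrite (eq_integral (cst (f x)%:E)); last first.
    move=> y; rewrite inE => yx /=; congr EFin; apply: fl => k; rewrite addn0; exact: yx.
  rewrite integral_cst; last exact: measurable_dyadic_interval.
  by rewrite [X in (_ * X)%E]haar_interval -EFinM mulrC.
rewrite dyadic_interval_split integral_setU.
- rewrite !IH; [|by rewrite addSnnS..].
  rewrite -EFinD; congr EFin; rewrite /= /coord_avg exprS invfM.
  by ring.
- exact: measurable_dyadic_interval.
- exact: measurable_dyadic_interval.
- apply/measurable_EFinP; apply: measurable_funTS; exact: measurable_level fl.
- apply/disj_setPS => y [/= h0 h1].
  by have := h0 l (ltnSn l); rewrite (h1 l (ltnSn l)) !set_coord_same.
Qed.

Lemma integral_mean N f y : level N f ->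
  (\int[mu]_x (f x)%:E = (cavg 0 N f y)%:E)%E.
Proof.
move=> fN; have := @integral_level 0 N f y fN; rewrite expr0 invr1 mul1r => <-.
congr (integral _ _ _).
by apply/seteqP; split.
Qed.

Lemma walsh_coef_fun_mean N f i y : level N f -> (i < 2 ^ N)%N ->
  walsh_coef_fun f i = cavg 0 N (fun t => f t * walsh i t) y.
Proof.
move=> fN iN; rewrite /walsh_coef_fun /Rintegral (@integral_mean N _ y)// => u v uv.
by rewrite (fN _ _ uv) (level_walsh iN uv).
Qed.

Lemma martingale_of_level N n f x : level N f -> martingale_of f n x = cavg n N f x.
Proof.
move=> fN; have fnN : level (n + N) f by apply: level_le fN; exact: leq_addl.
apply: (walsh_sum_pow2 x (y := x) fnN) => i iln; apply: walsh_coef_fun_mean => //.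
by apply: leq_trans iln _; rewrite leq_exp2l// leq_addr.
Qed.

Section martingales.
Variable F : nat -> dyadic_group -> R.
Hypothesis Fm : dyadic_martingale F.

Lemma martingale_level n : level n (F n).
Proof. by case: Fm => adapted _ _; apply: level_adapted; exact: adapted. Qed.

(** The martingale property tested on a single interval of generation [n]. *)
Lemma martingale_cavg n d x : cavg n d (F (n + d)%N) x = F n x.
Proof.
case: Fm => _ _ /(_ n (n + d)%N (dyadic_interval n x) (leq_addr _ _)) /=.
have In : dyadic_filtration n (dyadic_interval n x).
  by apply: sub_sigma_algebra; exists x.
move=> /(_ In); rewrite (@integral_level n d (F (n + d)%N) x)//; last exact: martingale_level.
have := @integral_level n 0 (F n) x; rewrite addn0 => /(_ (@martingale_level n)) -> /=.
by case=> /mulfI -> //; rewrite invr_eq0 expf_neq0.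
Qed.

(** The sequence defining the coefficient is constant from [N] on, since the Walsh
    function comes out of the conditional expectation. *)
Lemma walsh_coef_mean N i y : (i < 2 ^ N)%N ->
  walsh_coef F i = cavg 0 N (fun t => F N t * walsh i t) y.
Proof.
move=> iN; apply: norm_lim_near_cst; exists N => // n /= Nn.
have iw : (i < 2 ^ n)%N by apply: leq_trans iN _; rewrite leq_exp2l.
rewrite (walsh_coef_fun_mean y (@martingale_level n) iw) -(subnKC Nn) cavg_tower.
congr (cavg _ _ _ y); apply/funext => t; rewrite add0n.
have -> : (fun t0 => F (N + (n - N))%N t0 * walsh i t0) =
    fun t0 => walsh i t0 * F (N + (n - N))%N t0.
  by apply/funext => u; rewrite mulrC.
by rewrite cavg_pull ?martingale_cavg 1?mulrC//; exact: level_walsh.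
Qed.

Lemma walsh_sum_martingale n x : walsh_sum (walsh_coef F) (2 ^ n) x = F n x.
Proof.
have Fn := @martingale_level n.
rewrite (@walsh_sum_pow2 _ 0 n (F n) (walsh_coef F) x x) ?addn0//.
by move=> i; exact: walsh_coef_mean.
Qed.

(** The conditional expectations of a Cesaro mean split in two parts. As [S_k F]
    turns into [F n] when [k] exceeds [2 ^ n], the large [k] give a multiple of
    [F n] with factor at most 1; the small [k] form a combination of Dirichlet
    kernels with monotone weights. *)
Lemma martingale_of_cesaro_mean_le (alpha : R) N m n x : 0 < alpha < 1 -> (0 < N)%N ->
  (m < 2 ^ N)%N ->
  `|martingale_of (cesaro_mean alpha F m) n x| <=
    `|F n x| + 16 / cesaro_number alpha m * spread (2 `^ alpha) N (F N) x.
Proof.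
move=> alpha01 N0 mN; set A := cesaro_number alpha m.
have A0 : 0 < A by exact: cesaro_number_gt0.
pose a := cesaro_number (alpha - 1); pose S := walsh_sum (walsh_coef F).
have a0 u : 0 <= a u by exact: cesaro_number_pred_ge0.
have S0 y : S 0 y = 0 by rewrite /S /walsh_sum big_ord0.
have sE y : cesaro_mean alpha F m y = A^-1 * \sum_(0 <= k < m.+1) a (m - k)%N * S k y.
  by rewrite big_ltn// S0 mulr0 add0r.
have level_mean : level N (cesaro_mean alpha F m).
  move=> u v uv; rewrite !sE; congr (_ * _); rewrite !big_nat.
  apply: eq_bigr => k /andP[_ km]; congr (_ * _).
  by apply: (@level_walsh_sum _ _ k N) => //; lia.
rewrite (martingale_of_level _ _ level_mean).
have -> : cesaro_mean alpha F m = fun y => A^-1 * \sum_(0 <= k < m.+1) a (m - k)%N * S k y.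
  by apply/funext => y; rewrite sE.
rewrite cavgZ cavg_sum.
pose L := minn m.+1 (2 ^ n).+1.
have Lm : (L <= m.+1)%N by exact: geq_minl.
have -> : \sum_(0 <= k < m.+1) cavg n N (fun t => a (m - k)%N * S k t) x =
    \sum_(0 <= k < L) a (m - k)%N * S k x + (\sum_(L <= k < m.+1) a (m - k)%N) * F n x.
  have term k : (k < m.+1)%N ->
      cavg n N (fun t => a (m - k)%N * S k t) x = a (m - k)%N * S (minn k (2 ^ n)) x.
    move=> km; rewrite cavgZ /S cavg_walsh_sum//.
    apply: (@leq_trans (2 ^ N)); first by lia.
    by rewrite leq_exp2l// leq_addl.
  rewrite (@big_cat_nat _ _ _ L)//=; congr (_ + _).
    rewrite !big_nat; apply: eq_bigr => k /andP[_ kL].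
    by rewrite term ?(leq_trans kL)//; congr (_ * S _ x); move: kL; rewrite /L; lia.
  rewrite mulr_suml !big_nat; apply: eq_bigr => k /andP[Lk km].
  rewrite term// -walsh_sum_martingale; congr (_ * S _ x).
  by move: Lk km; rewrite /L; lia.
have LN : (L <= 2 ^ N)%N by apply: leq_trans Lm _.
have coefE i : (i < L)%N -> walsh_coef F i = cavg 0 N (fun t => F N t * walsh i t) x.
  by move=> iL; apply: walsh_coef_mean; exact: leq_trans LN.
have B := weighted_partial_sums_le x alpha01 N0 (@martingale_level N) Lm LN coefE.
have sum_a : 0 <= \sum_(L <= k < m.+1) a (m - k)%N <= A.
  rewrite sumr_ge0//= /A -cesaro_number_pred_sum -(big_mkord xpredT a).
  rewrite (big_nat_rev _ _ 0)/= add0n.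
  rewrite [leRHS](@big_cat_nat _ _ _ L)//= lerDr sumr_ge0// => k _; exact: a0.
rewrite normrM ger0_norm ?invr_ge0 ?(ltW A0)//.
rewrite mulrC ler_pdivrMr// (le_trans (ler_normD _ _))//.
rewrite mulrDl addrC lerD//.
  case/andP: sum_a => s0 sA.
  by rewrite normrM (ger0_norm s0) mulrC ler_wpM2l.
by apply: (le_trans B); rewrite mulrAC divfK// gt_eqF.
Qed.

End martingales.
End integrals.

(** * Hardy quasinorms *)

Section hardy_norms.
Context {R : realType}.
Local Notation mu := (@haar R).
Variable p : R.
Hypothesis p01 : 0 < p < 1.
Implicit Types (x t y : dyadic_group) (f : dyadic_group -> R) (F : nat -> dyadic_group -> R).
Local Open Scope ereal_scope.

Let p_gt0 : (0 < p)%R. Proof. by case/andP: p01. Qed.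

Lemma measurable_maximal_function F : (forall n, level n (F n)) ->
  measurable_fun setT (maximal_function F).
Proof.
move=> Fl; have -> : maximal_function F = fun x => esups (fun n => `|F n x|%:E) 0%N.
  apply/funext => x; rewrite /maximal_function /esups /sdrop; congr ereal_sup.
  by apply/seteqP; split => _ [n _ <-]; exists n.
apply: measurable_fun_esups => n; apply/measurable_EFinP.
apply: measurableT_comp => //; exact: measurable_level (Fl n).
Qed.

Lemma maximal_function_ge n F x : `|F n x|%:E <= maximal_function F x.
Proof. by apply: ereal_sup_ubound; exists n. Qed.

Lemma maximal_function_ge0 F x : 0 <= maximal_function F x.
Proof. by apply: le_trans (maximal_function_ge 0%N F x); rewrite lee_fin. Qed.

Lemma hardy_norm_powR F :
  hardy_norm p F `^ p = \int[mu]_x maximal_function F x `^ p.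
Proof.
rewrite /hardy_norm powR_Lnorm ?gt_eqF//; apply: eq_integral => x _.
by rewrite gee0_abs// maximal_function_ge0.
Qed.

Lemma poweR_le (u v : \bar R) : 0 <= u -> u <= v -> u `^ p <= v `^ p.
Proof.
move=> u0 uv; apply: gt0_ler_poweR => //; first exact: ltW.
- by rewrite in_itv/= u0 leey.
- by rewrite in_itv/= (le_trans u0 uv) leey.
Qed.

Lemma mean_powR_le_hardy F N f y : (forall n, level n (F n)) -> level N f ->
  (forall x, (0 <= f x)%R) -> (forall x, (f x)%:E <= maximal_function F x) ->
  (cavg 0 N (fun x => f x `^ p) y)%:E <= hardy_norm p F `^ p.
Proof.
move=> Fl fl f0 fF; have fpl : level N (fun x => f x `^ p)%R by move=> u v /fl ->.
rewrite hardy_norm_powR -(integral_mean y fpl); apply: ge0_le_integral => //.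
- by move=> x _; rewrite lee_fin powR_ge0.
- apply/measurable_EFinP; exact: measurable_level fpl.
- apply: (measurableT_comp (measurable_poweR _)); exact: measurable_maximal_function.
- by move=> x _; rewrite -poweR_EFin; apply: poweR_le; rewrite ?lee_fin.
Qed.

Lemma poweR_addr_le (u v : \bar R) : 0 <= u -> 0 <= v ->
  (u + v) `^ p <= u `^ p + v `^ p.
Proof.
case: u => [u| |] //; case: v => [v| |] // u0 v0.
- by rewrite -EFinD !poweR_EFin -EFinD lee_fin powR_addr_le.
- by rewrite addey// poweRyr ?gt_eqF// addey ?leey// poweR_EFin.
- by rewrite addye// poweRyr ?gt_eqF// addye ?leey// poweR_EFin.
- by rewrite addye// poweRyr ?gt_eqF// addye ?leey.
Qed.

Lemma hardy_norm_fun_le F g N f y : (forall n, level n (F n)) -> level N f ->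
  (forall x, (0 <= f x)%R) ->
  (forall n x, (`|martingale_of g n x| <= `|F n x| + f x)%R) ->
  hardy_norm_fun p g `^ p <=
    hardy_norm p F `^ p + (cavg 0 N (fun x => f x `^ p) y)%:E.
Proof.
move=> Fl fl f0 gFf; have fpl : level N (fun x => f x `^ p)%R by move=> u v /fl ->.
have gl n : level n (martingale_of g n) by exact: level_walsh_sum.
have mpow (h : dyadic_group -> \bar R) : measurable_fun setT h ->
    measurable_fun setT (fun x => h x `^ p).
  by move=> mh; exact: (measurableT_comp (measurable_poweR _)).
have mf : measurable_fun setT (EFin \o f).
  by apply/measurable_EFinP; exact: measurable_level fl.
have mF := measurable_maximal_function Fl.
rewrite /hardy_norm_fun !hardy_norm_powR -(integral_mean y fpl).
under [X in _ <= _ + X]eq_integral do rewrite -poweR_EFin.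
rewrite -ge0_integralD//; [|by move=> x _; exact: poweR_ge0|exact: mpow|
  by move=> x _; exact: poweR_ge0|exact: mpow].
apply: ge0_le_integral => //.
- by move=> x _; exact: poweR_ge0.
- by apply: mpow; exact: measurable_maximal_function.
- by apply: emeasurable_funD; exact: mpow.
move=> x _; apply: le_trans (poweR_addr_le _ _); rewrite ?maximal_function_ge0 ?lee_fin//.
apply: poweR_le; first exact: maximal_function_ge0.
apply: ge_ereal_sup => _ [n _ <-].
apply: (@le_trans _ _ (`|F n x| + f x)%:E); first by rewrite lee_fin.
by rewrite EFinD leeD2r// maximal_function_ge.
Qed.

End hardy_norms.

(** * Estimate of a single dyadic block *)

Section block_estimate.
Context {R : realType}.
Variables alpha p : R.
Hypothesis alpha01 : 0 < alpha < 1.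
Hypothesis p01 : 0 < p < 1.
Implicit Types (x y : dyadic_group) (F : nat -> dyadic_group -> R) (l d k n m N K : nat).

Local Notation pi2 := (2 `^ p).
Local Notation rho := ((2 `^ alpha) `^ p).
Local Notation kappa := (2 / 2 `^ p).

Let p_gt0 : 0 < p. Proof. by case/andP: p01. Qed.

Lemma mean_cavg_powR_le F l d K y : (forall k, level k (F k)) -> (l + d <= K)%N ->
  cavg 0 K (fun x => cavg l d (fun t => `|F (l + d)%N t|) x `^ p) y <=
  pi2 * (cavg 0 K (fun x => doubling F l x `^ p) y +
    \sum_(i < d) kappa ^+ i.+1 * cavg 0 K (fun x => jump F (l + i) x `^ p) y).
Proof.
move=> Fl ldK.
pose J i := cavg l i.+1 (fun t => jump F (l + i) t `^ p).
apply: (@le_trans _ _ (cavg 0 K (fun x => pi2 * (doubling F l x `^ p +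
    \sum_(i < d) kappa ^+ i.+1 * J i x)) y)).
  apply: cavg_le => x; apply: (@le_trans _ _ ((2 * cavg l d (doubling F (l + d)) x) `^ p)).
    apply: (powR_le p01); first by apply: cavg_ge0 => t.
    by rewrite -cavgZ; apply: cavg_le => t; exact: norm_le_doubling.
  rewrite powRM//; last by apply: cavg_ge0 => t; exact: doubling_ge0.
  by rewrite ler_wpM2l ?powR_ge0// cavg_doubling_powR_le.
rewrite cavgZ cavgD cavg_sum ler_wpM2l ?powR_ge0// lerD2l le_eqVlt; apply/orP; left.
apply/eqP; apply: eq_bigr => i _; rewrite cavgZ /J mean_cavg//.
  by apply: leq_trans ldK; rewrite leq_add2l.
rewrite addnS => u v uv; congr (_ `^ p); exact: (level_jump Fl uv).
Qed.

Let rho_gt1 : 1 < rho.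
Proof. by rewrite -powRrM powR2_gt1// mulr_gt0//; case/andP: alpha01. Qed.

Let pi2_gt1 : 1 < pi2. Proof. exact: powR2_gt1. Qed.

Let pi2_gt0 : 0 < pi2. Proof. exact: lt_trans pi2_gt1. Qed.

Lemma kappa_gt1 : 1 < kappa.
Proof.
rewrite ltr_pdivlMr// mul1r; have q0 : 0 < 1 - p by case/andP: p01; lra.
have := powR2_gt1 q0; rewrite powRB ?pnatr_eq0 ?implybT// powRr1//.
by rewrite ltr_pdivlMr// mul1r.
Qed.

Local Notation r := (rho * pi2 / 2).

(** Here [r < 1] makes the averages at coarse scales [l] summable for every jump;
    [H] bounds the part of [|F N|] already present at scale [l]. *)
Lemma mean_spread_le F N K H y : r < 1 -> (forall k, level k (F k)) -> (N <= K)%N ->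
  (forall l, (l <= K)%N -> cavg 0 K (fun x => doubling F l x `^ p) y <= H) ->
  cavg 0 K (fun x => spread (2 `^ alpha) N (F N) x `^ p) y <=
    2 * pi2 / (pi2 - 1) * (H * (rho ^+ N.+1 / (rho - 1)) + (1 - r)^-1 *
      \sum_(j < N) kappa ^+ j.+1 * cavg 0 K (fun x => jump F j x `^ p) y).
Proof.
move=> r1 Fl NK GH; pose b j := cavg 0 K (fun x => jump F j x `^ p) y.
have b0 j : 0 <= b j by apply: cavg_ge0 => t; exact: powR_ge0.
have H0 : 0 <= H.
  by apply: le_trans (GH 0%N _) => //; apply: cavg_ge0 => t; exact: powR_ge0.
apply: (le_trans (mean_spread_powR_le p01 _ _ (powR_ge0 _ _) NK)).
have c0 : 0 <= 2 / (pi2 - 1) by rewrite divr_ge0// subr_ge0 ltW.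
have -> z : 2 * pi2 / (pi2 - 1) * z = 2 / (pi2 - 1) * (pi2 * z) by ring.
rewrite ler_wpM2l//.
have step (l : 'I_N.+1) : rho ^+ l *
    cavg 0 K (fun x => cavg l (N - l) (fun t => `|F N t|) x `^ p) y <=
    pi2 * (rho ^+ l * H + rho ^+ l * \sum_(i < N - l) kappa ^+ i.+1 * b (l + i)%N).
  have lN : (l <= N)%N by rewrite -ltnS.
  rewrite -mulrDr mulrCA ler_wpM2l ?exprn_ge0 ?powR_ge0//.
  have := @mean_cavg_powR_le F l (N - l) K y Fl; rewrite subnKC// => /(_ NK) h.
  apply: (le_trans h); rewrite ler_wpM2l ?powR_ge0// lerD2r GH//.
  exact: leq_trans NK.
apply: le_trans; first by apply: ler_sum => l _; exact: step.
rewrite -mulr_sumr ler_wpM2l ?powR_ge0// big_split/= -mulr_suml.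
have rE : r = rho / kappa by field; rewrite gt_eqF.
apply: lerD.
  by rewrite mulrC ler_wpM2l// sum_geometric_le.
have k0 : 0 < kappa by exact: divr_gt0.
rewrite rE; apply: sum_shifted_le => //.
by rewrite -rE r1 andbT !mulr_gt0// (lt_trans ltr01).
Qed.

End block_estimate.

(** * Summation over the dyadic blocks *)

Section summation.
Context {R : realType}.
Variables alpha p : R.
Hypothesis alpha01 : 0 < alpha < 1.
Hypothesis hp : 0 < p < (1 + alpha)^-1.
Implicit Types (x y : dyadic_group) (F : nat -> dyadic_group -> R) (n m N K : nat).

Local Notation pi2 := (2 `^ p).
Local Notation rho := ((2 `^ alpha) `^ p).
Local Notation kappa := (2 / 2 `^ p).
Local Notation r := (rho * pi2 / 2).

Let p01 : 0 < p < 1.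
Proof.
case/andP: hp => p0 pa; rewrite p0 (lt_trans pa)// invf_lt1; last first.
  by case/andP: alpha01 => a0 _; rewrite addr_gt0.
by case/andP: alpha01 => a0 _; rewrite ltrDl.
Qed.

Let p_gt0 : 0 < p. Proof. by case/andP: p01. Qed.

Let rho_gt1 : 1 < rho.
Proof. by rewrite -powRrM powR2_gt1// mulr_gt0//; case/andP: alpha01. Qed.

Let pi2_gt1 : 1 < pi2. Proof. exact: powR2_gt1. Qed.

Let rho_gt0 : 0 < rho. Proof. exact: lt_trans rho_gt1. Qed.
Let pi2_gt0 : 0 < pi2. Proof. exact: lt_trans pi2_gt1. Qed.

Let rho_pi2E : rho * pi2 = 2 `^ ((1 + alpha) * p).
Proof. by rewrite -powRrM -powRD ?pnatr_eq0 ?implybT// mulrDl mul1r addrC. Qed.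

Let excess_gt0 : 0 < 1 - (1 + alpha) * p.
Proof.
have a0 : 0 < 1 + alpha by case/andP: alpha01 => a0 _; rewrite addr_gt0.
by case/andP: hp => _; rewrite -(ltr_pM2l a0) divff ?gt_eqF// subr_gt0.
Qed.

Let r_bounds : 0 < r < 1.
Proof.
rewrite divr_gt0 ?mulr_gt0//= ltr_pdivrMr// mul1r rho_pi2E.
have := powR2_gt1 excess_gt0; rewrite powRB ?pnatr_eq0 ?implybT// powRr1//.
by rewrite ltr_pdivlMr ?powR_gt0// mul1r.
Qed.

Let weight_pow2 : (2 `^ (2 - (1 + alpha) * p))^-1 = r / 2.
Proof.
have -> : 2 - (1 + alpha) * p = 1 + (1 - (1 + alpha) * p) by ring.
rewrite powRD ?pnatr_eq0 ?implybT// powRr1// powRB ?pnatr_eq0 ?implybT// powRr1//.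
rewrite -rho_pi2E; field.
by rewrite !gt_eqF.
Qed.

Lemma weight_le n m : (2 ^ n <= m)%N ->
  (m%:R `^ (2 - (1 + alpha) * p))^-1 <= (r / 2) ^+ n.
Proof.
move=> nm; set e := 2 - (1 + alpha) * p.
have e0 : 0 < e by rewrite /e; move: excess_gt0; lra.
rewrite -weight_pow2 exprVn lef_pV2 ?posrE ?exprn_gt0 ?powR_gt0//; last first.
  by rewrite ltr0n (leq_trans _ nm)// expn_gt0.
have -> : (2 `^ e) ^+ n = (2 ^ n)%:R `^ e.
  by rewrite natrX -!powR_mulrn ?powR_ge0// powRAC.
by apply: ge0_ler_powR; rewrite ?nnegrE ?ler_nat// ltW.
Qed.

Lemma cesaro_factor_le n m : (2 ^ n <= m)%N ->
  (16 / cesaro_number alpha m) `^ p <= 16 * (rho ^+ n)^-1.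
Proof.
move=> nm; set P := 2 `^ alpha.
have P0 : 0 < P by exact: powR_gt0.
have PA : P ^+ n <= cesaro_number alpha m.
  apply: le_trans (cesaro_number_ge alpha01 m).
  have -> : P ^+ n = (2 ^ n)%:R `^ alpha.
    by rewrite natrX -!powR_mulrn ?powR_ge0// powRAC.
  case/andP: alpha01 => a0 _.
  by apply: ge0_ler_powR; rewrite ?nnegrE ?ler_nat ?(ltW a0)// (leq_trans nm).
have A0 := cesaro_number_gt0 alpha01 m.
apply: (@le_trans _ _ ((16 / P ^+ n) `^ p)).
  apply: powR_le => //; first by rewrite divr_ge0// ltW.
  by rewrite ler_pM2l// lef_pV2 ?posrE ?exprn_gt0.
have Pn0 : 0 <= P ^+ n by rewrite exprn_ge0 ?ltW.
rewrite powRM ?invr_ge0// powRV// powR_exprn ?(ltW P0)//.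
apply: ler_wpM2r; first by rewrite invr_ge0 exprn_ge0 ?powR_ge0.
by rewrite ler1_powR ?ler1n//; case/andP: p01 => _ /ltW.
Qed.

Definition summation_constant : R :=
  (1 + 16 * (2 * pi2 / (pi2 - 1)) * (rho ^+ 2 / (rho - 1))) / (1 - r) +
  16 * (2 * pi2 / (pi2 - 1)) * (1 - r)^-1 * (kappa / (1 - kappa^-1)) * (1 - pi2^-1)^-1.

Section one_martingale.
Variables (F : nat -> dyadic_group -> R) (H : R).
Hypothesis Fm : dyadic_martingale F.
Hypothesis FH : (hardy_norm p F `^ p)%E = H%:E.

Let Fl : forall k, level k (F k). Proof. by move=> k; exact: martingale_level. Qed.
Let y0 : dyadic_group := fun=> false.
Let b K j := cavg 0 K (fun x => jump F j x `^ p) y0.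
Let Y K N := cavg 0 K (fun x => spread (2 `^ alpha) N (F N) x `^ p) y0.

Lemma mean_doubling_le K l : (l <= K)%N ->
  cavg 0 K (fun x => doubling F l x `^ p) y0 <= H.
Proof.
move=> lK; rewrite -lee_fin -FH; apply: mean_powR_le_hardy => //.
- exact: level_le (level_doubling Fl).
- by move=> x; exact: doubling_ge0.
- by move=> x; have [k ->] := doubling_attained F l x; exact: maximal_function_ge.
Qed.

Lemma sum_mean_jump_le K : \sum_(j < K) b K j <= (1 - pi2^-1)^-1 * H.
Proof.
rewrite /b -cavg_sum; apply: (@le_trans _ _
  (cavg 0 K (fun x => (1 - pi2^-1)^-1 * doubling F K x `^ p) y0)).
  by apply: cavg_le => x; exact: sum_jump_powR_le.
rewrite cavgZ ler_wpM2l ?mean_doubling_le//.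
by rewrite invr_ge0 subr_ge0 invf_le1// ltW.
Qed.

(** The weight and the factor [m ^ (- alpha)] are replaced by their values at the
    beginning of the block containing [m]. *)
Lemma cesaro_mean_term_le K n m : (n < K)%N -> (2 ^ n <= m < 2 ^ n.+1)%N ->
  (hardy_norm_fun p (cesaro_mean alpha F m) `^ p *
    ((m%:R `^ (2 - (1 + alpha) * p))^-1)%:E <=
   ((r / 2) ^+ n * (H + 16 * (rho ^+ n)^-1 * Y K n.+1))%:E)%E.
Proof.
move=> nK /andP[nm mn]; set A := 16 / cesaro_number alpha m.
pose f x := A * spread (2 `^ alpha) n.+1 (F n.+1) x.
have A0 : 0 <= A by rewrite divr_ge0// ltW// cesaro_number_gt0.
have sp0 x : 0 <= spread (2 `^ alpha) n.+1 (F n.+1) x.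
  by apply: spread_ge0; exact: powR_ge0.
have fl : level K f.
  apply: (level_le nK) => u v uv; congr (_ * _).
  exact: (level_spread _ (Fl (k := n.+1)) uv).
have := @hardy_norm_fun_le R p p01 F (cesaro_mean alpha F m) K f y0 Fl fl
  (fun x => mulr_ge0 A0 (sp0 x))
  (fun k x => martingale_of_cesaro_mean_le Fm k x alpha01 (ltn0Sn n) mn).
rewrite FH -EFinD => h.
have w0 : 0 <= (m%:R `^ (2 - (1 + alpha) * p))^-1 :> R by rewrite invr_ge0 powR_ge0.
apply: (le_trans (lee_wpmul2r _ h)); first by rewrite lee_fin.
have fY : cavg 0 K (fun x => f x `^ p) y0 = A `^ p * Y K n.+1.
  rewrite /Y -cavgZ; congr (cavg _ _ _ y0); apply/funext => x.
  by rewrite /f powRM.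
have Y0 : 0 <= Y K n.+1 by apply: cavg_ge0 => x; exact: powR_ge0.
have H0 : 0 <= H.
  by apply: le_trans (mean_doubling_le (leq0n K)); apply: cavg_ge0 => x; exact: powR_ge0.
rewrite fY -EFinM lee_fin mulrC.
apply: ler_pM => //; first by rewrite addr_ge0// mulr_ge0// powR_ge0.
  exact: weight_le.
by rewrite lerD2l ler_wpM2r// cesaro_factor_le.
Qed.

(** A block has [2 ^ n] terms, which turns the weight [(r / 2) ^ n] into [r ^ n]. *)
Lemma sum_cesaro_mean_terms_le K N : (N <= K)%N ->
  (\sum_(1 <= m < 2 ^ N) (hardy_norm_fun p (cesaro_mean alpha F m) `^ p *
     ((m%:R `^ (2 - (1 + alpha) * p))^-1)%:E) <=
   (\sum_(n < N) r ^+ n * (H + 16 * (rho ^+ n)^-1 * Y K n.+1))%:E)%E.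
Proof.
elim: N => [|N IH] NK; first by rewrite expn0 big_geq// big_ord0.
rewrite (@big_cat_nat _ _ _ (2 ^ N)%N)/= ?expn_gt0 ?leq_exp2l// big_ord_recr/= EFinD.
apply: leeD; first exact/IH/ltnW.
set t := H + _.
apply: (@le_trans _ _ (\sum_(2 ^ N <= m < 2 ^ N.+1) ((r / 2) ^+ N * t)%:E)%E).
  by rewrite !big_nat; apply: lee_sum => m mN; exact: cesaro_mean_term_le.
rewrite sumEFin lee_fin sumr_const_nat.
have -> : (2 ^ N.+1 - 2 ^ N = 2 ^ N)%N by rewrite expnS; lia.
rewrite -[leLHS]mulr_natl natrX mulrA -exprMn.
by rewrite [2 * _]mulrC divfK// mulrC.
Qed.

(** The part of the bound proportional to [H] carries the summable factor [r ^ n].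
    The part with the jumps carries [(r / rho) ^ n = kappa ^ (- n)], against which
    the growth [kappa ^ j] of the [j]-th jump is balanced. *)
Lemma sum_block_bounds_le K :
  \sum_(n < K) r ^+ n * (H + 16 * (rho ^+ n)^-1 * Y K n.+1) <= summation_constant * H.
Proof.
have /andP[r0 r1] := r_bounds.
set C1 := 2 * pi2 / (pi2 - 1).
have C1_ge0 : 0 <= C1 by rewrite /C1 divr_ge0 ?mulr_ge0 ?subr_ge0 ?ltW.
have H0 : 0 <= H.
  by apply: le_trans (mean_doubling_le (leq0n K)); apply: cavg_ge0 => x; exact: powR_ge0.
have b0 j : 0 <= b K j by apply: cavg_ge0 => x; exact: powR_ge0.
pose B n := \sum_(j < n.+1) kappa ^+ j.+1 * b K j.
pose D := 1 + 16 * C1 * (rho ^+ 2 / (rho - 1)).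
have k1 : 1 < kappa by exact: kappa_gt1.
have k0 : 0 < kappa by exact: lt_trans k1.
have step (n : 'I_K) : r ^+ n * (H + 16 * (rho ^+ n)^-1 * Y K n.+1) <=
    D * H * r ^+ n + 16 * C1 * (1 - r)^-1 * ((kappa ^+ n)^-1 * B n).
  have Yle := mean_spread_le alpha01 p01 r1 Fl (ltn_ord n) (@mean_doubling_le K).
  rewrite -/(Y K n.+1) -/C1 in Yle.
  have w0 : 0 <= r ^+ n * (16 * (rho ^+ n)^-1).
    by rewrite !mulr_ge0 ?exprn_ge0 ?invr_ge0 ?exprn_ge0// ltW.
  rewrite mulrDr [X in _ + X]mulrA.
  apply: (le_trans (lerD (lexx _) (ler_wpM2l w0 Yle))).
  have -> : (kappa ^+ n)^-1 = r ^+ n / rho ^+ n.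
    rewrite -exprVn -expr_div_n; congr (_ ^+ n); field.
    by rewrite !gt_eqF.
  rewrite le_eqVlt; apply/orP; left; apply/eqP; rewrite -/(B n) /D.
  rewrite !exprS expr0.
  have : rho ^+ n != 0 by rewrite expf_neq0// gt_eqF.
  have : rho - 1 != 0 by rewrite subr_eq0 gt_eqF.
  have : 1 - r != 0 by rewrite subr_eq0 gt_eqF.
  move: (B n) (r ^+ n) C1 {C1_ge0 w0 D Yle} => Bn rn C1.
  move: (rho ^+ n) => z; set q := (1 - r)^-1 => _.
  by move: q rho => q rho' h1 h2; field; rewrite h1 h2.
apply: le_trans; first by apply: ler_sum => n _; exact: step.
rewrite big_split/= -!mulr_sumr /summation_constant -/C1 -/D [leRHS]mulrDl.
have D0 : 0 <= D * H.
  apply: mulr_ge0 => //; apply: addr_ge0 => //; apply: mulr_ge0; first exact: mulr_ge0.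
  by rewrite divr_ge0 ?exprn_ge0 ?subr_ge0 ?(ltW rho_gt0) ?(ltW rho_gt1).
apply: lerD.
  rewrite [leRHS]mulrAC ler_wpM2l//.
  by apply: sum_geometric_lt1_le; rewrite r1 ltW.
have c0 : 0 <= 16 * C1 * (1 - r)^-1.
  by apply: mulr_ge0; [exact: mulr_ge0|rewrite invr_ge0 subr_ge0 ltW].
rewrite -[leRHS]mulrA -[leRHS]mulrA ler_wpM2l//.
apply: (le_trans (sum_blocks_le K k1 b0)).
rewrite ler_wpM2l ?sum_mean_jump_le//.
by rewrite divr_ge0 ?(ltW k0)// subr_ge0 invf_le1// ltW.
Qed.

End one_martingale.
End summation.

Theorem theorem2 (R : realType) (alpha p : R)
    (halpha : 0 < alpha < 1) (hp : 0 < p < (1 + alpha)^-1) :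
  exists c : R, forall F : nat -> dyadic_group -> R, hardy_space p F ->
    (\sum_(1 <= m <oo)
        (hardy_norm_fun p (cesaro_mean alpha F m) `^ p *
         ((m%:R `^ (2 - (1 + alpha) * p))^-1)%:E)
     <= c%:E * hardy_norm p F `^ p)%E.
Proof.
exists (summation_constant alpha p) => F [Fm Ffin].
have FH : (hardy_norm p F `^ p)%E = (fine (hardy_norm p F `^ p)%E)%:E.
  by rewrite fineK// ge0_fin_numE ?poweR_ge0// poweR_lty.
rewrite FH -EFinM.
have term0 m : (0 <= hardy_norm_fun p (cesaro_mean alpha F m) `^ p *
    ((m%:R `^ (2 - (1 + alpha) * p))^-1)%:E)%E.
  by rewrite mule_ge0 ?poweR_ge0// lee_fin invr_ge0 powR_ge0.
apply: lime_le; first by apply: is_cvg_nneseries => m _ _.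
near=> K.
have K1 : (K <= 2 ^ K)%N by exact/ltnW/ltn_expl.
have K0 : (0 < K)%N by near: K; exists 1%N.
apply: (@le_trans _ _ (\sum_(1 <= m < 2 ^ K) (hardy_norm_fun p (cesaro_mean alpha F m) `^ p *
    ((m%:R `^ (2 - (1 + alpha) * p))^-1)%:E)%E)).
  rewrite [leRHS](@big_cat_nat _ _ _ K)//=.
  by rewrite leeDl// sume_ge0.
apply: (le_trans (sum_cesaro_mean_terms_le halpha hp Fm FH (leqnn K))).
by rewrite lee_fin sum_block_bounds_le.
Unshelve. all: by end_near.
Qed.
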